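(* There is a polynomial-time algorithm that, given a split graph $G$ and two independent sets $I_s, I_t$ of $G$, decides whether $I_s \rightsquigarrow_2 I_t$.
   Context: A split graph is a graph whose vertex set can be partitioned into a clique and an independent set. For independent sets $I, J$ of a graph $G$, write $I \leftrightarrow_2 J$ if $|I \setminus J| = |J \setminus I| = 1$ and $\mathrm{dist}_G(u,v) \le 2$, where $I \setminus J = \{u\}$ and $J \setminus I = \{v\}$ (a token moves from $u$ to a vertex $v$ within distance $2$). Write $I \rightsquigarrow_2 J$ if there is a finite sequence $I = I_0, I_1, \dots, I_\ell = J$ ($\ell \ge 0$) of independent sets of $G$ with $I_j \leftrightarrow_2 I_{j+1}$ for all $0 \le j < \ell$. *)

(* Defs.v *)
From mathcomp Require Import all_boot.

Set Implicit Arguments.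
Unset Strict Implicit.
Unset Printing Implicit Defensive.

(* A finite simple graph is a symmetric irreflexive relation on a finType. *)
Section Reconfiguration.
Variables (V : finType) (e : rel V).

Definition independent (I : {set V}) : Prop := {in I &, forall x y, ~~ e x y}.

Definition clique (K : {set V}) : Prop :=
  {in K &, forall x y, x != y -> e x y}.

Definition split_graph : Prop :=
  exists K : {set V}, clique K /\ independent (~: K).

(* A walk of length d; the distance is the least such d, and is infinite (no d
   satisfies [dist_is u v d]) when u and v lie in different components. *)
Definition walk (u v : V) (d : nat) : Prop :=
  exists p : seq V, [/\ path e u p, last u p = v & size p = d].

Definition dist_is (u v : V) (d : nat) : Prop :=
  walk u v d /\ forall d', walk u v d' -> d <= d'.

Definition dist_le (u v : V) (k : nat) : Prop :=
  exists2 d, dist_is u v d & d <= k.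

Definition move2 (I J : {set V}) : Prop :=
  exists u v, [/\ I :\: J = [set u], J :\: I = [set v] & dist_le u v 2].

Definition reach2 (I J : {set V}) : Prop :=
  exists (l : nat) (s : nat -> {set V}),
    [/\ s 0 = I, s l = J,
        forall j, j <= l -> independent (s j)
      & forall j, j < l -> move2 (s j) (s j.+1)].

End Reconfiguration.

(* Algorithms are programs of a random access machine in the style of Cook and
   Reckhow: registers indexed by nat and holding naturals, addition and
   truncated subtraction, indirect addressing, conditional jumps.  The input is
   a read-only array of naturals.  Every instruction costs one step; as there
   is no multiplication, t steps create only numbers whose bit length exceeds
   that of the input and program constants by at most t, so polynomial time
   here coincides with polynomial time on Turing machines. *)
Inductive instr : Type :=
  | IConst (i c : nat)
  | IAdd (i j k : nat)
  | ISub (i j k : nat)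
  | ILoad (i j : nat)
  | IStore (i j : nat)
  | IRead (i j : nat)
  | IJpos (i l : nat)
  | IHalt (b : bool).

Definition program := seq instr.

Record config := Config { pc : nat; reg : nat -> nat }.

(* Running off the end of the program stops with the answer "no". *)
Definition fetch (P : program) (s : config) : instr := nth (IHalt false) P (pc s).

Definition set_reg (s : config) (i v : nat) : config :=
  Config (pc s).+1 [eta reg s with i |-> v].

Definition step (P : program) (w : seq nat) (s : config) : config :=
  let R := reg s in
  match fetch P s with
  | IConst i c => set_reg s i c
  | IAdd i j k => set_reg s i (R j + R k)
  | ISub i j k => set_reg s i (R j - R k)
  | ILoad i j => set_reg s i (R (R j))
  | IStore i j => set_reg s (R i) (R j)
  | IRead i j => set_reg s i (nth 0 w (R j))
  | IJpos i l => Config (if 0 < R i then l else (pc s).+1) R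
  | IHalt _ => s
  end.

Definition init : config := Config 0 (fun=> 0).

(* On input w, P reaches after t steps an instruction answering b. *)
Definition answers (P : program) (w : seq nat) (t : nat) (b : bool) : Prop :=
  fetch P (iter t (step P w) init) = IHalt b.

(* The number of vertices, the adjacency matrix row by row, and the two
   characteristic vectors: 1 + n ^ 2 + 2 n entries, each at most max(n, 1). *)
Definition encode (n : nat) (e : rel 'I_n) (I J : {set 'I_n}) : seq nat :=
  n :: [seq nat_of_bool (e x y) | x <- enum 'I_n, y <- enum 'I_n]
    ++ [seq nat_of_bool (x \in I) | x <- enum 'I_n]
    ++ [seq nat_of_bool (x \in J) | x <- enum 'I_n].

(* Main.v *)
(* Let K be the clique and S the independent part.  Two vertices of S with a
   common neighbour exchange tokens freely, so a configuration inside S matters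
   only through its number of tokens (or of holes) on each component of the
   common-neighbour graph on S; the neighbours in S of a vertex c of K lie in a
   single component, and let d(c) be their number.  A token can be brought to c
   iff that component has at least d(c) - 1 holes (d(c) holes, if a token is
   already in K), and once c carries a token, any other token can be moved
   anywhere: so all configurations from which c can be occupied are mutually
   reachable.  A configuration with D holes can have enough holes for both c and
   c' iff (d(c) - 1) + (d(c') - 1) <= D, and, up to replacing c by a vertex
   c' of the same component with d(c') <= d(c), this is also the only way for
   a move to lose c; the regions of the c satisfying this with the vertex
   minimizing d merge into one, and the others stay isolated.  Tokens on
   isolated vertices never move.

   This criterion is a formula over counting, quantification over vertices and
   connectivity.  A function of the graph is called computable when register
   machine code evaluates it in polynomial time; such functions are closed under
   arithmetic, tests and loops over the vertices, which also cover connectivity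
   once a set of vertices is stored as a single number in binary. *)
Require Import Defs.
From mathcomp Require Import all_boot zify.

Set Implicit Arguments.
Unset Strict Implicit.
Unset Printing Implicit Defensive.

(** * Moves and reachability *)

Section Reach.
Variables (V : finType) (e : rel V).
Hypotheses (esym : symmetric e).

Lemma dist_le2P (u v : V) :
  dist_le e u v 2 <-> [\/ u = v, e u v | exists2 w, e u w & e w v].
Proof.
split.
- case=> d [[p [pth lst <-]] _].
  case: p pth lst => [|x [|y [|z p]]] //=.
  + by move=> _ -> _; constructor 1.
  + by rewrite andbT => exu <- _; constructor 2.
  + by rewrite andbT => /andP[exu eyx] <- _; constructor 3; exists x.
- have least p : path e u p -> last u p = v -> size p <= 2 -> dist_le e u v 2.
    have [k] := ubnP (size p); elim: k p => // k IH p le_pk pth lst le_p2.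
    (* Tuples make the existence of a walk of given length decidable, so a least length exists; it
       is at most that of the given walk. *)
    pose Q d' := [exists t : d'.-tuple V, path e u t && (last u t == v)].
    have exQ : exists d', Q d'.
      by exists (size p); apply/existsP; exists (in_tuple p); rewrite pth lst eqxx.
    case: (ex_minnP exQ) => m /existsP[t /andP[tp /eqP tl]] mmin.
    exists m; last first.
      apply: leq_trans le_p2; apply: mmin.
      by apply/existsP; exists (in_tuple p); rewrite pth lst eqxx.
    split; first by exists t; rewrite size_tuple.
    move=> d' [q [qp ql <-]]; apply: mmin.
    by apply/existsP; exists (in_tuple q); rewrite qp ql eqxx.
  case=> [uv|euv|[w euw ewv]].
  + exact: (least [::]).
  + by apply: (least [:: v]); rewrite //= euv.
  + by apply: (least [:: w; v]); rewrite //= euw ewv.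
Qed.

Lemma dist_le2_sym (u v : V) : dist_le e u v 2 -> dist_le e v u 2.
Proof.
rewrite !dist_le2P => -[->|euv|[w euw ewv]]; first by constructor 1.
- by constructor 2; rewrite esym.
- by constructor 3; exists w; rewrite esym.
Qed.

Lemma move2_sym I J : move2 e I J -> move2 e J I.
Proof. by case=> u [v [? ? /dist_le2_sym]]; exists v, u. Qed.

Lemma move2_replace (I : {set V}) u v :
  u \in I -> v \notin I -> dist_le e u v 2 -> move2 e I (v |: I :\ u).
Proof.
move=> uI vI duv; exists u, v; split=> //; apply/setP=> x; rewrite !inE.
- have [->|] := eqVneq x u; last by case: (x \in I); rewrite ?andbF ?andbT ?orbF ?andNb // orbT.
  by rewrite uI orbF andbT; apply: contraNneq vI => <-.
- have [->|] := eqVneq x v; first by rewrite vI.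
  by case: (x \in I); rewrite ?andbF.
Qed.

Lemma move2E (I J : {set V}) : move2 e I J ->
  exists u v, [/\ u \in I, v \notin I, J = v |: I :\ u, u != v & dist_le e u v 2].
Proof.
case=> u [v [/setP IJ /setP JI duv]]; exists u, v.
have := IJ u; have := JI v; rewrite !inE !eqxx => /andP[vI vJ] /andP[uJ uI].
split=> //; last by apply: contraNneq vI => <-.
apply/setP=> x; have := IJ x; have := JI x; rewrite !inE.
case: (eqVneq x v) => [->|xv]; first by rewrite vJ.
by case: (eqVneq x u) => [->|xu]; [case: (u \in J) uJ | case: (x \in I); case: (x \in J)].
Qed.

Lemma reach2_refl I : independent e I -> reach2 e I I.
Proof. by move=> iI; exists 0, (fun=> I); split. Qed.

Lemma reach2_step I J L :
  independent e I -> move2 e I J -> reach2 e J L -> reach2 e I L.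
Proof.
move=> iI mIJ [l [s [s0 sl si sm]]].
exists l.+1, (fun j => if j is j'.+1 then s j' else I); split=> //.
- by case=> // j; exact: si.
- by case=> [_|j lt_j] /=; [rewrite s0 | exact: sm].
Qed.

Lemma reach2_ind (P : {set V} -> Prop) I J :
  P I -> (forall L L', independent e L -> independent e L' -> move2 e L L' ->
          P L -> P L') ->
  reach2 e I J -> P J.
Proof.
move=> PI Pstep [l [s [s0 <- si sm]]].
have: l <= l by []; elim: {-2}l => [_|k IH lt_kl]; first by rewrite s0.
by apply: (Pstep (s k)); [apply: si; lia | exact: si | exact: sm | apply: IH; lia].
Qed.

Lemma reach2_indep I J : reach2 e I J -> independent e I /\ independent e J.
Proof. by case=> l [s [<- <- si _]]; split; apply: si. Qed.

Lemma reach2_trans I J L : reach2 e I J -> reach2 e J L -> reach2 e I L.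
Proof.
case=> l; elim: l I => [|l IH] I [s [s0 sl si sm]]; first by rewrite -s0 sl.
move=> rJL; apply: (reach2_step (J := s 1)).
- by rewrite -s0; apply: si.
- by rewrite -s0; apply: sm.
apply: IH rJL; exists (fun j => s j.+1); split=> // j lt_j; [exact: si | exact: sm].
Qed.

Lemma reach2_move I J :
  independent e I -> independent e J -> move2 e I J -> reach2 e I J.
Proof. by move=> iI iJ mIJ; apply: reach2_step iI mIJ (reach2_refl iJ). Qed.

Lemma reach2_sym I J : reach2 e I J -> reach2 e J I.
Proof.
move=> rIJ; have [iI _] := reach2_indep rIJ.
apply: (reach2_ind (P := fun L => reach2 e L I)) rIJ; first exact: reach2_refl.
by move=> L L' iL iL' /move2_sym m r; apply: reach2_step r.
Qed.

End Reach.

(** * The reachability criterion *)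

Definition touched (V : finType) (e : rel V) v := [exists w, e v w].

Definition meet (V : finType) (e : rel V) (S : pred V) : rel V :=
  fun u v => [&& S u, S v & [exists c, e u c && e v c]].

Definition comp (V : finType) (e : rel V) (S : pred V) v : {set V} :=
  [set u | connect (meet e S) v u].

Definition deg (V : finType) (e : rel V) (S : pred V) c :=
  #|[set u | S u && e c u]|.

Definition inside (V : finType) (S : pred V) (I : {set V}) :=
  [forall v, (v \in I) ==> S v].

(* Tokens can be rearranged so that one reaches c, where u is any neighbour of c
   in S; stated additively to avoid truncated subtraction. *)
Definition gate (V : finType) (e : rel V) (S : pred V) (I : {set V}) c u :=
  [&& ~~ S c, S u, e c u &
      #|comp e S u :&: I| + deg e S c <= #|comp e S u| + inside S I].

(* With D holes among the non-isolated vertices of S (for a configuration inside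
   S), this is (d(c) - 1) + (d(m) - 1) <= D; it only depends on the number of
   movable tokens. *)
Definition roomy (V : finType) (e : rel V) (S : pred V) (I : {set V}) c m :=
  deg e S c + deg e S m + #|[set v in I | touched e v]|
    <= #|[set v | S v && touched e v]| + 2.

(** [roomy] gets easier as [deg m] decreases, so [m] can be taken of least degree; that vertex is
    the meeting point in [hub_reach]. *)
Definition hub (V : finType) (e : rel V) (S : pred V) (I : {set V}) :=
  [exists c, exists u, exists m, [&& gate e S I c u, ~~ S m & roomy e S I c m]].

Definition samecount (V : finType) (e : rel V) (S : pred V) (I J : {set V}) :=
  [&& inside S I, inside S J &
      [forall v, S v ==> (#|comp e S v :&: I| == #|comp e S v :&: J|)]].

Definition samegate (V : finType) (e : rel V) (S : pred V) (I J : {set V}) :=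
  [exists c, exists u, gate e S I c u && gate e S J c u].

(** Collects the invariants of a single move. *)
Definition compatible (V : finType) (e : rel V) (I J : {set V}) :=
  (#|I| == #|J|) && [forall v, touched e v || ((v \in I) == (v \in J))].

(** The disjuncts cover configurations linked without using the clique, configurations sharing a
    vertex that both can occupy, and the one large class into which compatible hubs merge. *)
Definition decide (V : finType) (e : rel V) (S : pred V) (I J : {set V}) :=
  compatible e I J &&
  [|| samecount e S I J, samegate e S I J | hub e S I && hub e S J].

Section Main.
Variables (V : finType) (e : rel V) (S : pred V).
Hypotheses (esym : symmetric e) (eirr : irreflexive e).
Hypothesis Sindep : forall x y, S x -> S y -> ~~ e x y.
Hypothesis Kclique : forall x y, ~~ S x -> ~~ S y -> x != y -> e x y.
(** Lets a token on the clique always step down into [S], and makes every clique vertex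
    non-isolated. The partition supplied later is chosen to satisfy it. *)
Hypothesis Knbr : forall c, ~~ S c -> exists2 u, S u & e c u.

Notation H := (meet e S).
Notation comp := (comp e S).
Notation deg := (deg e S).
Notation gate := (gate e S).
Notation hub := (hub e S).

Implicit Types (I J X Y : {set V}) (c u v w : V).

(** * Components of the common-neighbour graph and invariants of moves *)

Lemma insideP I : reflect (forall v, v \in I -> S v) (inside S I).
Proof.
apply: (iffP forallP) => IS v; first by move=> vI; apply: (implyP (IS v)).
by apply/implyP/IS.
Qed.

Lemma inside_indep I : inside S I -> independent e I.
Proof. by move/insideP=> IS x y xI yI; apply: Sindep; apply: IS. Qed.

Lemma meet_sym : symmetric H.
Proof.
move=> u v; rewrite /meet andbCA; congr [&& _, _ & _].
by apply: eq_existsb => c; rewrite andbC.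
Qed.

Lemma connect_meet_sym : connect_sym H.
Proof. by apply: sym_connect_sym; exact: meet_sym. Qed.

Lemma connect_S u v : S u -> connect H u v -> S v.
Proof.
move=> Su /connectP[p]; elim: p u Su => [|x p IH] u Su /= => [_ -> //|].
by case/andP=> /and3P[_ Sx _]; apply: IH.
Qed.

Lemma mem_comp u v : (v \in comp u) = connect H u v.
Proof. by rewrite inE. Qed.

Lemma comp_eq u v : connect H u v -> comp u = comp v.
Proof.
move=> uv; apply/setP=> w; rewrite !mem_comp.
by rewrite (same_connect connect_meet_sym uv).
Qed.

Lemma comp_S u v : S u -> v \in comp u -> S v.
Proof. by rewrite mem_comp; apply: connect_S. Qed.

Lemma comp_nbr c u v : S u -> S v -> e c u -> e c v -> v \in comp u.
Proof.
move=> Su Sv ecu ecv; rewrite mem_comp; apply: connect1.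
by rewrite /meet Su Sv; apply/existsP; exists c; rewrite !(esym _ c) ecu.
Qed.

Lemma nbrK u c : S u -> e u c -> ~~ S c.
Proof. by move=> Su; apply: contraL => Sc; apply: Sindep. Qed.

Lemma touchedP v : reflect (exists w, e v w) (touched e v).
Proof. exact: existsP. Qed.

Lemma K_touched c : ~~ S c -> touched e c.
Proof. by case/Knbr=> u _ ecu; apply/touchedP; exists u. Qed.

(** From [S] one step leads into the clique and a second one to [c]. Hence any movable token can
    jump onto any clique vertex in a single move, independence permitting. *)
Lemma dist_K u c : ~~ S c -> touched e u -> dist_le e u c 2.
Proof.
move=> Kc /touchedP[w euw]; rewrite dist_le2P.
have [->|uc] := eqVneq u c; first by constructor 1.
have [Su|Ku] := boolP (S u); last by constructor 2; apply: Kclique.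
have [<-|wc] := eqVneq w c; first by constructor 2.
by constructor 3; exists w => //; apply: Kclique => //; apply: nbrK euw.
Qed.

Lemma dist_meet u v : H u v -> dist_le e u v 2.
Proof.
case/and3P=> _ _ /existsP[c /andP[uc vc]]; rewrite dist_le2P.
by constructor 3; exists c => //; rewrite esym.
Qed.

Lemma move2_touched u v : u != v -> dist_le e u v 2 -> touched e u && touched e v.
Proof.
rewrite dist_le2P => uv [uv'|euv|[w euw ewv]]; first by rewrite uv' eqxx in uv.
- by apply/andP; split; apply/touchedP; [exists v | exists u; rewrite esym].
- by apply/andP; split; apply/touchedP; exists w; rewrite // esym.
Qed.

Lemma replace_inside I u v : inside S I -> S v -> inside S (v |: I :\ u).
Proof.
move/insideP=> IS Sv; apply/insideP=> x; rewrite !inE.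
by case/orP=> [/eqP-> //|/andP[_ /IS]].
Qed.

Lemma card_replace I u v : u \in I -> v \notin I -> #|v |: I :\ u| = #|I|.
Proof. by move=> uI vI; rewrite cardsU1 (cardsD1 u I) uI !inE (negbTE vI) andbF. Qed.

(** Stated additively, so that one equation covers all cases of membership of [u] and [v] in [A]. *)
Lemma card_replaceI (A : {set V}) I u v : u \in I -> v \notin I ->
  #|A :&: (v |: I :\ u)| + (u \in A) = #|A :&: I| + (v \in A).
Proof.
move=> uI vI.
have {2}-> : I = u |: (I :\ u) by rewrite setD1K.
have vIu : v \notin I :\ u by rewrite !inE (negbTE vI) andbF.
have uIu : u \notin I :\ u by rewrite !inE eqxx.
have add w X : w \notin X -> #|A :&: (w |: X)| = (w \in A) + #|A :&: X|.
  move=> wX; rewrite setIUr; have [wA|wA] := boolP (w \in A).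
    rewrite (setIidPr _) ?sub1set // cardsU1 !inE.
    by rewrite (negbTE wX) andbF.
  have -> : A :&: [set w] = set0.
    by apply/setP=> x; rewrite !inE; case: eqP => [->|]; rewrite ?andbF ?(negbTE wA).
  by rewrite set0U.
by rewrite !add //; lia.
Qed.

Lemma compatible_refl I : compatible e I I.
Proof. by rewrite /compatible eqxx; apply/forallP=> v; rewrite eqxx orbT. Qed.

Lemma compatible_sym I J : compatible e I J = compatible e J I.
Proof.
rewrite /compatible eq_sym; congr (_ && _).
by apply: eq_forallb => v; rewrite (eq_sym (v \in I)).
Qed.

Lemma compatible_trans I J X :
  compatible e I J -> compatible e J X -> compatible e I X.
Proof.
rewrite /compatible.
case/andP=> /eqP-> /forallP IJ /andP[-> /forallP JX]; apply/forallP=> v.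
by have := IJ v; have := JX v; case: touched => //= /eqP <-.
Qed.

Lemma move2_compatible I J : move2 e I J -> compatible e I J.
Proof.
case/move2E=> u [v [uI vI -> uv /(move2_touched uv) /andP[tu tv]]].
rewrite /compatible card_replace // eqxx; apply/forallP=> x; rewrite !inE.
have [->|xv] := eqVneq x v; first by rewrite tv.
have [->|xu] := eqVneq x u; first by rewrite tu.
by rewrite /= eqxx orbT.
Qed.

Lemma reach2_compatible I J : reach2 e I J -> compatible e I J.
Proof.
apply: (reach2_ind (P := compatible e I)) => [|L L' _ _ /move2_compatible LL' IL].
  exact: compatible_refl.
exact: compatible_trans IL LL'.
Qed.

Lemma compatible_mem I J v : compatible e I J -> v \in I -> v \notin J -> touched e v.
Proof. by case/andP=> _ /forallP/(_ v) + vI vJ; rewrite vI (negbTE vJ) orbF. Qed.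

Lemma compatible_touched I J : compatible e I J ->
  #|[set v in I | touched e v]| = #|[set v in J | touched e v]|.
Proof.
case/andP=> /eqP cIJ /forallP IJ.
have split X : #|X| = #|[set v in X | touched e v]| + #|[set v in X | ~~ touched e v]|.
  rewrite -(cardsID [set v | touched e v] X); congr (_ + _); apply: eq_card => v.
    by rewrite !inE.
  by rewrite !inE andbC.
move: cIJ; rewrite (split I) (split J).
suff ->: [set v in I | ~~ touched e v] = [set v in J | ~~ touched e v] by move/addIn.
by apply/setP=> v; rewrite !inE; have := IJ v; case: touched; rewrite ?andbF //= => /eqP->.
Qed.

(** * Sufficiency of the criterion *)

Lemma slide I u v : inside S I -> u \in I -> v \notin I -> connect H u v ->
  reach2 e I (v |: I :\ u).
Proof.
move=> IS uI vI /connectP[p pth vE].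
elim: p => [|x p IH] in I u IS uI vI pth vE *; first by rewrite vE uI in vI.
move: pth vE => /= /andP[ux pth] vE.
have uv : u != v by apply: contraNneq vI => <-.
have [xv|xv] := eqVneq x v.
  have Sv : S v by rewrite -xv; case/and3P: ux.
  apply: reach2_move; try exact: inside_indep.
    exact/inside_indep/replace_inside.
  by apply: move2_replace => //; rewrite -xv; apply: dist_meet.
have Sx : S x by case/and3P: ux.
have Sv : S v by apply: (connect_S Sx); apply/connectP; exists p.
have [eux|xu] := eqVneq u x; first by subst x; apply: IH.
(* If the next vertex [x] of the path is occupied, its token is sent to [v] first and the token of
   [u] then takes its place. *)
have [xI|xI] := boolP (x \in I).
  apply: (reach2_trans (J := v |: I :\ x)); first exact: IH.
  have -> : v |: I :\ u = x |: (v |: I :\ x) :\ u.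
    apply/setP=> y; rewrite !inE; have [->|yx] := eqVneq y x.
      by rewrite (eq_sym x u) xu xI orbT.
    have [->|yv] := eqVneq y v; last by [].
    by rewrite (eq_sym v u) uv.
  apply: reach2_move.
  - exact/inside_indep/replace_inside.
  - by apply/inside_indep/replace_inside => //; apply: replace_inside.
  - apply: move2_replace; [by rewrite !inE uI xu orbT | | exact: dist_meet].
    by rewrite !inE eqxx (negbTE xv).
apply: (reach2_trans (J := x |: I :\ u)).
  apply: reach2_move; [exact: inside_indep | exact/inside_indep/replace_inside |].
  by apply: move2_replace => //; apply: dist_meet.
have -> : v |: I :\ u = v |: (x |: I :\ u) :\ x.
  apply/setP=> y; rewrite !inE; have [//|yv] := eqVneq y v.
  by have [->|//] := eqVneq y x; rewrite (negbTE xI) andbF.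
apply: IH => //; first exact: replace_inside.
- by rewrite !inE eqxx.
- by rewrite !inE eq_sym (negbTE xv) (negbTE vI) andbF.
Qed.

(** By equality of counts, a token of [I] outside [J] has in its component a hole of [I] where [J]
    has a token; sliding it there shrinks the difference. *)
Lemma samecount_reach I J : samecount e S I J -> reach2 e I J.
Proof.
have [k] := ubnP #|I :\: J|; elim: k I => // k IH I le_k sIJ.
have /and3P[IS JS /forallP IJ] := sIJ.
have cIJ v : S v -> #|comp v :&: I| = #|comp v :&: J|.
  by move=> Sv; apply/eqP; apply: (implyP (IJ v)).
have [IJ0|[u]] := set_0Vmem (I :\: J).
  suff -> : J = I by apply/reach2_refl/inside_indep.
  have sub : I \subset J by rewrite -setD_eq0 IJ0.
  apply/eqP; rewrite eqEsubset sub andbT; apply/subsetP=> v vJ.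
  have Sv := insideP _ JS v vJ.
  have : comp v :&: I == comp v :&: J by rewrite eqEcard setIS //= cIJ ?leqnn.
  by move/eqP/setP/(_ v); rewrite !inE vJ connect0.
rewrite !inE => /andP[uJ uI]; have Su := insideP _ IS u uI.
have [v [vC vI vJ]] : exists v, [/\ v \in comp u, v \notin I & v \in J].
  have /subsetPn[v]: ~~ (comp u :&: J \subset comp u :&: I).
    apply/negP => sub; have : comp u :&: J == comp u :&: I.
      by rewrite eqEcard sub cIJ ?leqnn.
    by move/eqP/setP/(_ u); rewrite !inE uI (negbTE uJ) connect0.
  by rewrite !inE => /andP[uv vJ]; rewrite uv /= => vI; exists v; rewrite inE.
have Sv := comp_S Su vC; have uv : connect H u v by rewrite -mem_comp.
apply: (reach2_trans (slide IS uI vI uv)).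
apply: IH.
  rewrite ltnS in le_k; apply: leq_trans le_k; apply: proper_card; apply/properP; split.
    apply/subsetP=> x; rewrite !inE => /andP[xJ /orP[/eqP xv|/andP[_ ->]]].
      by rewrite xv vJ in xJ.
    by rewrite xJ.
  exists u; rewrite !inE ?uI ?uJ //= eqxx /= orbF.
  by apply: contraNneq vI => <-.
apply/and3P; split; [exact: replace_inside | exact: JS |].
apply/forallP=> w; apply/implyP => Sw; rewrite -cIJ //.
have := card_replaceI (comp w) uI vI.
by rewrite !mem_comp (same_connect_r connect_meet_sym uv) => /addIn ->.
Qed.

Lemma nbr_comp c u : S u -> e c u -> [set x | S x && e c x] \subset comp u.
Proof.
by move=> Su ecu; apply/subsetP=> x; rewrite inE => /andP[Sx ecx]; apply: comp_nbr ecu ecx.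
Qed.

Lemma indep_K I c x : independent e I -> c \in I -> ~~ S c -> x \in I ->
  x != c -> S x /\ ~~ e c x.
Proof.
move=> iI cI Kc xI xc; split; last exact: iI.
by apply: contraNT (iI x c xI cI) => Kx; apply: Kclique.
Qed.

Lemma indep_addK X c : ~~ S c -> (forall x, x \in X -> S x /\ ~~ e c x) ->
  independent e (c |: X).
Proof.
move=> Kc XS x y; rewrite !inE => /predU1P[->|/XS[Sx ncx]] /predU1P[->|/XS[Sy ncy]] //.
- by rewrite eirr.
- by rewrite esym.
- exact: Sindep.
Qed.

Lemma ex_subset_card (A : {set V}) k :
  k <= #|A| -> exists2 Z : {set V}, Z \subset A & #|Z| = k.
Proof.
elim: k => [|k IH] le_k; first by exists set0; rewrite ?sub0set ?cards0.
have [Z ZA cZ] := IH (ltnW le_k).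
have /subsetPn[x xA xZ] : ~~ (A \subset Z).
  by apply: contraL le_k => /subset_leq_card; rewrite cZ -leqNgt.
by exists (x |: Z); rewrite ?cardsU1 ?xZ ?cZ // subUset sub1set xA.
Qed.

Lemma ex_between_card (A B : {set V}) k : A \subset B -> #|A| <= k <= #|B| ->
  exists Z : {set V}, [/\ A \subset Z, Z \subset B & #|Z| = k].
Proof.
move=> AB /andP[Ak kB]; have cB : #|B :\: A| = #|B| - #|A|.
  by rewrite cardsD (setIidPr AB).
have [Z ZBA cZ] := @ex_subset_card (B :\: A) (k - #|A|) ltac:(lia).
exists (A :|: Z); split; first exact: subsetUl.
  by rewrite subUset AB (subset_trans ZBA) ?subsetDl.
have AZ0 : A :&: Z = set0.
  apply/setP=> x; rewrite !inE; apply/negP=> /andP[xA /(subsetP ZBA)].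
  by rewrite inE xA.
by rewrite cardsU AZ0 cards0 cZ; lia.
Qed.

Lemma comp_disjoint u v x : x \in comp u -> x \in comp v -> comp u = comp v.
Proof. by rewrite !mem_comp => ux vx; rewrite (comp_eq ux) (comp_eq vx). Qed.

(** The tokens of the component are packed into [u] and the non-neighbours of [c], where the gate
    inequality leaves enough room. Then at most one token is adjacent to [c], and moving that one,
    or any movable token if there is none, onto [c] is legal. *)
Lemma gate_token_inside I c u : inside S I -> gate I c u ->
  (exists2 w, w \in I & touched e w) -> exists2 J, reach2 e I J & c \in J.
Proof.
move=> IS /and4P[Kc Su ecu]; rewrite IS => le_g [w wI tw].
set C := comp u in le_g; set nb := [set x | S x && e c x].
have nbC : nb \subset C by apply: nbr_comp.
have unb : u \in nb by rewrite inE Su.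
have cT : #|u |: (C :\: nb)| = (#|C| - deg c).+1.
  by rewrite cardsU1 inE unb /= cardsD (setIidPr nbC).
have [Z ZT cZ] := @ex_subset_card (u |: (C :\: nb)) #|C :&: I| ltac:(lia).
have ZC x : x \in Z -> (x == u) || (x \in C) && (x \notin nb).
  by move/(subsetP ZT); rewrite in_setU1 in_setD andbC.
have uC : u \in C by rewrite mem_comp connect0.
have ZsubC x : x \in Z -> x \in C by case/ZC/orP => [/eqP->|/andP[]].
pose J := (I :\: C) :|: Z.
have JS : inside S J.
  apply/insideP=> x; rewrite in_setU in_setD => /orP[/andP[_ /(insideP _ IS)] //|].
  by move/ZsubC/(comp_S Su).
have rIJ : reach2 e I J.
  apply: samecount_reach; rewrite /samecount IS JS; apply/forallP=> v.
  apply/implyP=> Sv; apply/eqP.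
  (* Components are equal or disjoint, and only the component of [u] is rearranged, keeping its
     number of tokens. *)
  have [[x xC xv]|dis] : (exists2 x, x \in C & x \in comp v) \/
      (forall x, x \in comp v -> x \notin C).
    have [/existsP[x /andP[]]|] := boolP [exists x, (x \in C) && (x \in comp v)].
      by left; exists x.
    by move/existsPn=> no; right=> x xv; have := no x; rewrite xv andbT.
  - rewrite -(comp_disjoint xC xv) -/C -cZ; apply: eq_card => y.
    rewrite in_setI in_setU in_setD; case yC: (y \in C) => //=.
    by apply: contraFF yC => /ZsubC.
  - apply: eq_card => y; rewrite !in_setI in_setU in_setD.
    case yv: (y \in comp v) => //=; rewrite (dis y yv) /=.
    by rewrite (contraNF (ZsubC y)) ?orbF //; apply: dis.
have Jnb x : x \in J -> x != u -> ~~ e c x.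
  move=> xJ xu; have Sx := insideP _ JS x xJ; apply/negP => ecx.
  have xnb : x \in nb by rewrite inE Sx.
  move: xJ; rewrite in_setU in_setD (subsetP nbC) //= => /ZC.
  by rewrite (negbTE xu) xnb andbF.
have [w' [w'J tw' w'nb]] : exists w', [/\ w' \in J, touched e w' &
    forall x, x \in J -> x != w' -> ~~ e c x].
  have [uJ|uJ] := boolP (u \in J).
    by exists u; split=> //; apply/touchedP; exists c; rewrite esym.
  have /card_gt0P[w'] : 0 < #|[set v in J | touched e v]|.
    rewrite -(compatible_touched (reach2_compatible rIJ)).
    by apply/card_gt0P; exists w; rewrite inE wI.
  rewrite inE => /andP[w'J tw']; exists w'; split=> // x xJ _; apply: Jnb => //.
  by apply: contraNneq uJ => <-.
exists (c |: J :\ w'); last by rewrite !inE eqxx.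
apply: (reach2_trans rIJ); apply: reach2_move; first exact: inside_indep.
  apply: indep_addK => // x; rewrite in_setD1 => /andP[xw xJ].
  by split; [exact: (insideP _ JS) | exact: w'nb].
apply: move2_replace => //; last exact: dist_K.
by apply: contra Kc => /(insideP _ JS).
Qed.

Lemma not_inside I : ~~ inside S I -> exists2 c, c \in I & ~~ S c.
Proof.
by case/forallPn=> c; rewrite negb_imply => /andP[cI Kc]; exists c.
Qed.

(** A neighbour in [S] of the occupied clique vertex is free by independence, and no second token
    lies on the clique. *)
Lemma unload I c : independent e I -> c \in I -> ~~ S c ->
  exists y, [/\ touched e y, y \notin I, inside S (y |: I :\ c) & reach2 e I (y |: I :\ c)].
Proof.
move=> iI cI Kc; have [y Sy ecy] := Knbr Kc; exists y.
have yI : y \notin I by apply: contraL ecy => yI; apply: iI.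
have IS : inside S (y |: I :\ c).
  apply/insideP=> x; rewrite !inE => /orP[/eqP->|/andP[xc xI]] //.
  by have [] := indep_K iI cI Kc xI xc.
split=> //; first by apply/touchedP; exists c; rewrite esym.
apply: reach2_move => //; first exact: inside_indep.
by apply: move2_replace => //; rewrite dist_le2P; constructor 2.
Qed.

Lemma gate_token I c u : independent e I -> gate I c u ->
  (exists2 w, w \in I & touched e w) -> exists2 J, reach2 e I J & c \in J.
Proof.
move=> iI gI wI; have [IS|] := boolP (inside S I); first exact: gate_token_inside gI wI.
move=> nIS; have [c0 c0I Kc0] := not_inside nIS.
have [y [ty yI JS rIJ]] := unload iI c0I Kc0.
have [] := @gate_token_inside (y |: I :\ c0) c u JS.
(* Unloading adds at most one token to the component, and the term [inside], rising from 0 to 1,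
   makes up for it. *)
- move: gI; rewrite /gate JS (negbTE nIS) => /and4P[-> -> -> /=].
  by have := card_replaceI (comp u) c0I yI; case: (c0 \in _); case: (y \in _) => /=; lia.
- by exists y; rewrite // !inE eqxx.
by move=> J rJ cJ; exists J => //; apply: reach2_trans rJ.
Qed.

Lemma reach_shared I J c : independent e I -> independent e J -> ~~ S c ->
  c \in I -> c \in J -> compatible e I J -> reach2 e I J.
Proof.
have [k] := ubnP #|I :\: J|; elim: k I => // k IH I le_k iI iJ Kc cI cJ cIJ.
have /andP[/eqP cardIJ _] := cIJ.
have [IJ0|[x]] := set_0Vmem (I :\: J).
  have -> : I = J by apply/eqP; rewrite eqEcard -setD_eq0 IJ0 eqxx cardIJ /=.
  exact: reach2_refl.
rewrite inE => /andP[xJ xI].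
have /subsetPn[y yJ yI] : ~~ (J \subset I).
  apply/negP=> sub; have /eqP JI : J == I by rewrite eqEcard sub cardIJ /=.
  by rewrite JI xI in xJ.
have xc : x != c by apply: contraNneq xJ => ->.
have yc : y != c by apply: contraNneq yI => ->.
have tx := compatible_mem cIJ xI xJ.
have ty : touched e y by apply: compatible_mem yJ yI; rewrite compatible_sym.
have [Sx _] := indep_K iI cI Kc xI xc; have [Sy ncy] := indep_K iJ cJ Kc yJ yc.
have xy : x != y by apply: contraNneq yI => <-.
pose I1 := y |: I :\ c; pose I2 := c |: I1 :\ x.
have I1S : inside S I1.
  apply/insideP=> z; rewrite !inE => /orP[/eqP-> //|/andP[zc zI]].
  by have [] := indep_K iI cI Kc zI zc.
have iI2 : independent e I2.
  apply: indep_addK => // z; rewrite !inE => /andP[zx /orP[/eqP-> //|/andP[zc zI]]].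
  exact: indep_K zI zc.
have rI2 : reach2 e I I2.
  apply: (reach2_trans (J := I1)).
    apply: reach2_move; [by [] | exact: inside_indep |].
    by apply: move2_replace => //; apply: (dist_le2_sym esym); apply: dist_K.
  apply: reach2_move; [exact: inside_indep | by [] |].
  apply: move2_replace; [by rewrite !inE xc xI orbT | | exact: dist_K].
  by rewrite !inE eq_sym (negbTE yc) eqxx.
apply: (reach2_trans rI2); apply: IH => //.
- rewrite ltnS in le_k; apply: leq_trans le_k; apply: proper_card.
  apply/properP; split; last by exists x; rewrite !inE ?xI ?xJ // eqxx /= orbF xc.
  apply/subsetP=> z; rewrite !inE => /andP[zJ]; rewrite zJ /=.
  case/orP=> [/eqP zc|/andP[_ /orP[/eqP zy|/andP[] //]]].
    by rewrite zc cJ in zJ.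
  by rewrite zy yJ in zJ.
- by rewrite !inE eqxx.
- apply: compatible_trans cIJ; rewrite compatible_sym.
  exact: reach2_compatible.
Qed.

Lemma gate_reach I J c u : independent e I -> independent e J -> compatible e I J ->
  gate I c u -> gate J c u -> reach2 e I J.
Proof.
move=> iI iJ cIJ gI gJ; have Kc : ~~ S c by case/and4P: gI.
have cT := compatible_touched cIJ.
(* Without movable tokens compatibility forces equality; otherwise both sides bring a token to
   [c]. *)
have [T0|[w]] := set_0Vmem [set v in I | touched e v].
  have U0 : [set v in J | touched e v] = set0.
    by apply/eqP; rewrite -cards_eq0 -cT T0 cards0.
  suff -> : J = I by apply: reach2_refl.
  apply/setP=> v; case/andP: cIJ => _ /forallP/(_ v).
  move/setP/(_ v): T0; move/setP/(_ v): U0; rewrite !inE.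
  by case: touched; rewrite ?andbT; [move=> -> -> | move=> _ _ /eqP].
rewrite inE => /andP[wI tw].
have [I' rI cI'] := @gate_token I c u iI gI ltac:(by exists w).
have /card_gt0P[w'] : 0 < #|[set v in J | touched e v]|.
  by rewrite -cT; apply/card_gt0P; exists w; rewrite inE wI.
rewrite inE => /andP[w'J tw'].
have [J' rJ cJ'] := @gate_token J c u iJ gJ ltac:(by exists w').
apply: (reach2_trans rI); apply: (reach2_trans _ (reach2_sym esym rJ)).
have [_ iI'] := reach2_indep rI; have [_ iJ'] := reach2_indep rJ.
apply: (reach_shared iI' iJ' Kc cI' cJ').
apply: compatible_trans (reach2_compatible rJ).
by apply: compatible_trans cIJ; rewrite compatible_sym; apply: reach2_compatible.
Qed.

Lemma inside_rep I : independent e I -> exists2 J, inside S J & reach2 e I J.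
Proof.
move=> iI; have [IS|] := boolP (inside S I); first by exists I => //; apply: reach2_refl.
move=> nIS; have [c cI Kc] := not_inside nIS.
by have [y [_ _ JS rIJ]] := unload iI cI Kc; exists (y |: I :\ c).
Qed.

(** The tokens of the component and the neighbours of [c] other than [u] are disjoint subsets of the
    component, so it has at least [deg c - 1] holes. *)
Lemma gate_avoid I c u : inside S I -> ~~ S c -> S u -> e c u ->
  (forall x, x \in I -> S x -> e c x -> x = u) -> gate I c u.
Proof.
move=> IS Kc Su ecu av; rewrite /gate Kc Su ecu IS /=.
set nb := [set x | S x && e c x]; have nbC : nb \subset comp u := nbr_comp Su ecu.
have unb : u \in nb by rewrite inE Su.
rewrite -[deg c]/(#|nb|) (cardsD1 u nb) unb.
suff : #|(comp u :&: I) :|: (nb :\ u)| <= #|comp u|.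
  rewrite cardsU; set X := _ :&: (nb :\ u); suff -> : X = set0 by rewrite cards0; lia.
  apply/setP=> x; rewrite !inE; apply/negP.
  case/andP=> /andP[_ xI] /and3P[xu Sx ecx].
  by rewrite (av x) ?eqxx in xu.
apply: subset_leq_card; rewrite subUset subsetIl /=.
by apply: subset_trans nbC; apply: subsetDl.
Qed.

(** The holes are prescribed: all neighbours of [c] but one, all neighbours of [m] but one, and
    arbitrary further ones. Only compatibility of [J] with [I] is claimed; in [hub_reach] the shared
    gate [c] turns it into reachability. *)
Lemma roomy_gates I c u m um : independent e I -> ~~ S c -> ~~ S m ->
  S u -> e c u -> S um -> e m um -> roomy e S I c m ->
  exists J, [/\ inside S J, compatible e I J, gate J c u & gate J m um].
Proof.
move=> iI Kc Km Su ecu Sum emum room.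
set M := [set v | S v && touched e v].
set Y0 := ([set x | S x && e c x] :\ u) :|: ([set x | S x && e m x] :\ um).
have touchedK x w : ~~ S w -> e w x -> touched e x.
  by move=> _ ewx; apply/touchedP; exists w; rewrite esym.
have Y0M : Y0 \subset M.
  apply/subsetP=> x; rewrite !inE.
  by case/orP=> /and3P[_ -> /touchedK ->].
have cY0 : #|Y0| + 2 <= deg c + deg m.
  have := cardsU ([set x | S x && e c x] :\ u) ([set x | S x && e m x] :\ um).
  rewrite -/Y0 /deg (cardsD1 u [set x | S x && e c x]) (cardsD1 um [set x | S x && e m x]).
  by rewrite !inE Su ecu Sum emum; lia.
(* Makes the subtraction below exact. As [I] may have a token on the clique, the bound is read off a
   representative inside [S]. *)
have tI : #|[set v in I | touched e v]| <= #|M|.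
  have [L LS /reach2_compatible/compatible_touched ->] := inside_rep iI.
  apply: subset_leq_card; apply/subsetP=> x; rewrite !inE => /andP[xL ->].
  by rewrite (insideP _ LS).
have [|Y [Y0Y YM cY]] := @ex_between_card Y0 M (#|M| - #|[set v in I | touched e v]|) Y0M.
  by move: room; rewrite /roomy -/M; lia.
pose J := [set v in I | ~~ touched e v] :|: (M :\: Y).
have JS : inside S J.
  apply/insideP=> x; rewrite !inE => /orP[/andP[_]|/and3P[_ -> _]] //.
  by apply: contraR => /K_touched.
exists J; split=> //.
- rewrite /compatible; apply/andP; split; last first.
    apply/forallP=> v; rewrite !inE.
    by case: touched; rewrite /= ?andbF ?andbT ?orbF ?eqxx.
  rewrite -(cardsID [set v | touched e v] I).
  rewrite -(cardsID [set v | touched e v] J) /=; apply/eqP; congr (_ + _).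
    transitivity #|M :\: Y|.
      rewrite cardsD (setIidPr YM) cY subKn //.
      by apply: eq_card => x; rewrite !inE.
    by apply: eq_card => x; rewrite !inE; case: touched; rewrite ?andbF ?andbT ?orFb.
  by apply: eq_card => x; rewrite !inE; case: touched; rewrite ?andbF ?andbT ?orbF.
- apply: gate_avoid => // x xJ Sx ecx; apply/eqP; apply: contraTT xJ => xu.
  rewrite !inE (touchedK x c) // andbF /= negb_and negbK (subsetP Y0Y) //.
  by rewrite !inE xu Sx ecx.
- apply: gate_avoid => // x xJ Sx emx; apply/eqP; apply: contraTT xJ => xu.
  rewrite !inE (touchedK x m) // andbF /= negb_and negbK (subsetP Y0Y) //.
  by rewrite !inE xu Sx emx orbT.
Qed.

(** With [m0] a clique vertex of least degree, the route goes from [I] to [X] through the gate [c],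
    from [X] to [Y] through [m0], and from [Y] to [J] through [c']. *)
Lemma hub_reach I J : independent e I -> independent e J -> compatible e I J ->
  hub I -> hub J -> reach2 e I J.
Proof.
move=> iI iJ cIJ /existsP[c /existsP[u /existsP[m /and3P[gI Km rI]]]].
case/existsP=> c' /existsP[u' /existsP[m' /and3P[gJ Km' rJ]]].
have [m0 /= Km0 minm] := @arg_minnP _ m [pred w | ~~ S w] deg Km.
have [um Sum emum] := Knbr Km0.
have /and4P[Kc Su ecu _] := gI; have /and4P[Kc' Su' ecu' _] := gJ.
have [|X [XS cX gX gmX]] := @roomy_gates I c u m0 um iI Kc Km0 Su ecu Sum emum.
  by apply: leq_trans rI; rewrite !leq_add2r leq_add2l; apply: minm.
have [|Y [YS cY gY gmY]] := @roomy_gates J c' u' m0 um iJ Kc' Km0 Su' ecu' Sum emum.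
  by apply: leq_trans rJ; rewrite !leq_add2r leq_add2l; apply: minm.
have iX := inside_indep XS; have iY := inside_indep YS.
apply: (reach2_trans (gate_reach iI iX cX gI gX)).
apply: (reach2_trans _ (reach2_sym esym (gate_reach iJ iY cY gJ gY))).
apply: gate_reach gmX gmY => //; apply: compatible_trans cY.
by apply: compatible_trans cIJ; rewrite compatible_sym.
Qed.

Lemma decide_reach I J : independent e I -> independent e J ->
  decide e S I J -> reach2 e I J.
Proof.
move=> iI iJ /andP[cIJ /or3P[/samecount_reach //||/andP[hI hJ]]]; last exact: hub_reach.
by case/existsP=> c /existsP[u /andP[gI gJ]]; apply: gate_reach gI gJ.
Qed.

(** * Necessity of the criterion *)

Lemma meet_dist u v : S u -> S v -> u != v -> dist_le e u v 2 -> H u v.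
Proof.
move=> Su Sv uv; rewrite dist_le2P => -[uv'|euv|[w uw wv]].
- by rewrite uv' eqxx in uv.
- by have := Sindep Su Sv; rewrite euv.
by rewrite /meet Su Sv; apply/existsP; exists w; rewrite uw esym.
Qed.

Lemma roomy_compatible I J c m : compatible e I J -> roomy e S I c m = roomy e S J c m.
Proof. by move/compatible_touched; rewrite /roomy => ->. Qed.

Lemma roomy_sym I c m : roomy e S I c m = roomy e S I m c.
Proof. by rewrite /roomy (addnC (deg c)). Qed.

Lemma move2_inside I J v : move2 e I J -> inside S I -> inside S J -> S v ->
  #|comp v :&: J| = #|comp v :&: I|.
Proof.
case/move2E=> x [y [xI yI -> xy dxy]] /insideP IS /insideP JS Sv.
have xyH : H x y by apply: meet_dist => //; [apply: IS | apply: JS; rewrite !inE eqxx].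
have := card_replaceI (comp v) xI yI.
by rewrite !mem_comp (same_connect_r connect_meet_sym (connect1 xyH)) => /addIn.
Qed.

(** Moves within [S] keep all component counts; a descent from the clique adds at most one token to
    the component, and [inside] compensates for it. *)
Lemma gate_inside I J c u : move2 e I J -> inside S J -> gate I c u -> gate J c u.
Proof.
move=> mIJ JS; rewrite /gate JS => /and4P[-> Su -> le_g]; rewrite Su /=.
have [IS|nIS] := boolP (inside S I).
  by rewrite (move2_inside mIJ IS JS Su); move: le_g; rewrite IS.
have [x [y [xI yI JE _ _]]] := move2E mIJ.
move: le_g; rewrite (negbTE nIS); have := card_replaceI (comp u) xI yI.
by rewrite -JE; case: (x \in _); case: (y \in _) => /=; lia.
Qed.

(** By independence all neighbours of the occupied [c] in [S] are holes. *)
Lemma gate_self I c u : independent e I -> c \in I -> ~~ S c -> S u -> e c u ->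
  gate I c u.
Proof.
move=> iI cI Kc Su ecu; rewrite /gate Kc Su ecu /=; apply: leq_trans (leq_addr _ _).
set nb := [set x | S x && e c x]; have nbC : nb \subset comp u := nbr_comp Su ecu.
rewrite -[deg c]/(#|nb|).
suff : #|(comp u :&: I) :|: nb| <= #|comp u|.
  rewrite cardsU; set X := _ :&: nb; suff -> : X = set0 by rewrite cards0; lia.
  apply/setP=> x; rewrite !inE; apply/negP.
  by case/andP=> /andP[_ xI] /andP[_ ecx]; have := iI _ _ cI xI; rewrite ecx.
by apply: subset_leq_card; rewrite subUset subsetIl.
Qed.

Lemma comp_touched u : touched e u -> S u -> comp u \subset [set v | S v && touched e v].
Proof.
move=> tu Su; apply/subsetP=> v uv; rewrite inE (comp_S Su uv) /=.
move: uv; rewrite mem_comp connect_meet_sym => /connectP[[|x p] /=].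
  by move=> _ <-.
by case/andP=> /and3P[_ _ /existsP[c /andP[vc _]]] _ _; apply/touchedP; exists c.
Qed.

(** A gate can be lost only when a token climbs from [S] onto a clique vertex [y], which is then a
    gate itself. If [y] is attached to the same component, its degree fits into the remaining holes
    and so is at most that of [c]. Otherwise the holes for [c] and for [y] lie in disjoint
    components, and their sum gives [roomy]. *)
Lemma gate_lose I J c u : independent e I -> independent e J -> move2 e I J ->
  gate I c u -> ~~ gate J c u ->
  exists c' u', gate J c' u' /\
    (roomy e S J c c' \/ comp u = comp u' /\ deg c' <= deg c).
Proof.
move=> iI iJ mIJ gI ngJ; have /and4P[Kc Su ecu le_g] := gI.
have [JS|nJS] := boolP (inside S J); first by rewrite (gate_inside mIJ) in ngJ.
have [x [y [xI yI JE xy dxy]]] := move2E mIJ.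
have cnt := card_replaceI (comp u) xI yI; rewrite -JE in cnt.
have yJ : y \in J by rewrite JE !inE eqxx.
have xJ : x \notin J by rewrite JE !inE eqxx (negbTE xy).
have nC w : ~~ S w -> w \notin comp u by apply: contra => /(comp_S Su).
have {ngJ} gt_g : #|comp u| < #|comp u :&: J| + deg c.
  by rewrite ltnNge; move: ngJ; rewrite /gate Kc Su ecu (negbTE nJS) addn0.
have [IS|nIS] := boolP (inside S I).
  have Ky : ~~ S y.
    apply: contra nJS => Sy; rewrite JE; exact: replace_inside.
  have [u' Su' eyu'] := Knbr Ky; have gJ := gate_self iJ yJ Ky Su' eyu'.
  exists y, u'; split=> //.
  have /and4P[_ _ _] := gJ; rewrite (negbTE nJS) addn0 => le_g'.
  rewrite IS in le_g.
  have [Cuu'|Cuu'] := eqVneq (comp u) (comp u').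
    right; split=> //; rewrite -(leq_add2l #|comp u' :&: J|).
    by apply: leq_trans le_g' _; rewrite -Cuu' ltnW.
  left; rewrite (negbTE (nC y Ky)) in cnt.
  set M := [set v | S v && touched e v].
  have tu : touched e u by apply/touchedP; exists c; rewrite esym.
  have tu' : touched e u' by apply/touchedP; exists y; rewrite esym.
  have disC : comp u :&: comp u' = set0.
    apply/setP=> z; rewrite in_set0 in_setI; apply/negP => /andP[zu zu'].
    by rewrite (comp_disjoint zu zu') eqxx in Cuu'.
  have holes : #|comp u :\: J| + #|comp u' :\: J| <= #|M :\: J|.
    rewrite -cardsUI; suff -> : (comp u :\: J) :&: (comp u' :\: J) = set0.
      rewrite cards0 addn0; apply: subset_leq_card.
      by rewrite -setDUl setSD // subUset !comp_touched.
    by rewrite -setDIl disC set0D.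
  (* The successor accounts for [y], the only token of [J] on the clique. *)
  have tJ : #|[set v in J | touched e v]| <= #|M :&: J|.+1.
    rewrite -add1n -(cards1 y) (leq_trans _ (leq_card_setU _ _)) //.
    apply: subset_leq_card; apply/subsetP=> z; rewrite !inE => /andP[zJ tz].
    have [//|zy] := eqVneq z y; have [Sz _] := indep_K iJ yJ Ky zJ zy.
    by rewrite Sz tz zJ.
  move: cnt le_g le_g' holes tJ (cardsID J (comp u)) (cardsID J (comp u')) (cardsID J M).
  rewrite /roomy -/M; move: (nat_of_bool (x \in _)) (deg c) (deg y) => b dc dy.
  do 9 move: #|_|; clear; move=> /= *; lia.
(* With clique tokens before and after, the move stays within one component of [S] or within the
   clique, so the count in the component of [u] is unchanged and the gate is kept. *)
have [a aI Ka] := not_inside nIS; have [b bJ Kb] := not_inside nJS.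
have only w : w \in I -> ~~ S w -> w = a.
  move=> wI; apply: contraNeq => wa.
  by have [] := indep_K iI aI Ka wI wa.
have same : (x \in comp u) = (y \in comp u).
  have [Sx|Kx] := boolP (S x).
    have aJ : a \in J.
      by rewrite JE !inE aI andbT (contraNneq _ Ka) ?orbT // => ->.
    have ya : y != a by apply: contraNneq yI => ->.
    have [Sy _] := indep_K iJ aJ Ka yJ ya.
    rewrite !mem_comp; apply: (same_connect_r connect_meet_sym).
    exact/connect1/meet_dist.
  have Ky : ~~ S y.
    move: bJ; rewrite JE !inE => /orP[/eqP <- //|/andP[bx bI]].
    by rewrite (only b) // (only x) // eqxx in bx.
  by rewrite (negbTE (nC x Kx)) (negbTE (nC y Ky)).
move: cnt; rewrite same => /addIn cnt.
by move: le_g; rewrite (negbTE nIS) addn0 -cnt leqNgt gt_g.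
Qed.

(** The criterion is propagated move by move: [samecount] can turn into [samegate], and [samegate]
    into the hub case, which is never left. *)
Lemma reach_decide I J : reach2 e I J -> decide e S I J.
Proof.
move=> rIJ; have [iI _] := reach2_indep rIJ.
apply: (reach2_ind (P := fun L => decide e S I L)) rIJ.
  rewrite /decide compatible_refl /=; have [IS|nIS] := boolP (inside S I).
    by rewrite /samecount IS; apply/orP; left; apply/forallP => v; rewrite eqxx implybT.
  have [c cI Kc] := not_inside nIS; have [u Su ecu] := Knbr Kc.
  apply/or3P; constructor 2; apply/existsP; exists c; apply/existsP; exists u.
  by rewrite (gate_self iI).
move=> L L' iL iL' mLL' /andP[cIL cases].
have cLL' := move2_compatible mLL'; have cIL' := compatible_trans cIL cLL'.
rewrite /decide cIL' /=; case/or3P: cases => [/and3P[IS LS /forallP IL]||].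
- have cIL1 v : S v -> #|comp v :&: I| = #|comp v :&: L|.
    by move=> Sv; apply/eqP; apply: (implyP (IL v)).
  have [L'S|nL'S] := boolP (inside S L').
    apply/or3P; constructor 1; rewrite /samecount IS L'S; apply/forallP=> v.
    by apply/implyP=> Sv; rewrite (move2_inside mLL') // cIL1.
  have [c cL' Kc] := not_inside nL'S; have [u Su ecu] := Knbr Kc.
  have gL' := gate_self iL' cL' Kc Su ecu.
  (* By reversing the move, a gate of [L'] is one of [L], hence of [I], which has the same
     counts. *)
  have := gate_inside (move2_sym esym mLL') LS gL'.
  rewrite /gate LS -cIL1 // => gI.
  apply/or3P; constructor 2; apply/existsP; exists c; apply/existsP; exists u.
  by rewrite gL' /gate IS gI.
- case/existsP=> c /existsP[u /andP[gI gL]].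
  have [gL'|ngL'] := boolP (gate L' c u).
    apply/or3P; constructor 2; apply/existsP; exists c; apply/existsP; exists u.
    by rewrite gI.
  (* A lost gate is either paired with [c'], making both sides hubs, or replaced by a [c'] of no
     larger degree on the same component, which is then a gate of [I] as well. *)
  have [c' [u' [gL' [room|[Cuu' le_d]]]]] := gate_lose iL iL' mLL' gL ngL'.
    have /and4P[Kc _ _ _] := gI; have /and4P[Kc' _ _ _] := gL'.
    apply/or3P; constructor 3; apply/andP; split.
      apply/existsP; exists c; apply/existsP; exists u; apply/existsP; exists c'.
      by rewrite gI Kc' (roomy_compatible _ _ cIL').
    apply/existsP; exists c'; apply/existsP; exists u'; apply/existsP; exists c.
    by rewrite gL' Kc roomy_sym.
  apply/or3P; constructor 2; apply/existsP; exists c'; apply/existsP; exists u'.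
  rewrite gL' andbT; move: gL' gI; rewrite /gate => /and4P[-> -> -> _] /and4P[_ _ _].
  by rewrite -Cuu' => /(leq_trans _)-> //; rewrite leq_add2l.
case/andP=> hI hL; apply/or3P; constructor 3; rewrite hI /=.
case/existsP: hL => c /existsP[u /existsP[m /and3P[gL Km rL]]].
have [gL'|ngL'] := boolP (gate L' c u).
  apply/existsP; exists c; apply/existsP; exists u; apply/existsP; exists m.
  by rewrite gL' Km -(roomy_compatible _ _ cLL').
have /and4P[Kc _ _ _] := gL.
have [c' [u' [gL' room]]] := gate_lose iL iL' mLL' gL ngL'.
apply/existsP; exists c'; apply/existsP; exists u'.
case: room => [room|[_ le_d]]; apply/existsP.
  by exists c; rewrite gL' Kc roomy_sym.
exists m; rewrite gL' Km; move: rL.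
by rewrite (roomy_compatible _ _ cLL'); apply: leq_trans; rewrite !leq_add2r.
Qed.

Lemma decideP I J : independent e I -> independent e J ->
  decide e S I J <-> reach2 e I J.
Proof. by move=> iI iJ; split; [apply: decide_reach | apply: reach_decide]. Qed.

End Main.

(** * A canonical split partition *)

Definition simplicial (V : finType) (e : rel V) v :=
  [forall x, forall y, [&& e v x, e v y & x != y] ==> e x y].

(* Adjacent simplicial vertices are true twins, so adjacency is an equivalence on
   them; keeping the least vertex of each class gives an independent set whose
   complement is a clique as soon as the graph is split. *)
Definition least_simplicial n (e : rel 'I_n) : pred 'I_n :=
  fun v => simplicial e v && ~~ [exists u : 'I_n, [&& u < v, e u v & simplicial e u]].

Section Partition.
Variables (n : nat) (e : rel 'I_n).
Hypotheses (esym : symmetric e) (eirr : irreflexive e).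

Lemma simplicialP v : reflect (forall x y, e v x -> e v y -> x != y -> e x y) (simplicial e v).
Proof.
apply: (iffP forallP) => [vS x y vx vy xy|vS x].
  by have /forallP/(_ y)/implyP := vS x; apply; rewrite vx vy.
by apply/forallP=> y; apply/implyP=> /and3P[]; apply: vS.
Qed.

Lemma simplicial_twin u v x : simplicial e u -> e u v -> e u x -> x != v -> e v x.
Proof. by move/simplicialP=> uS uv ux xv; apply: uS; rewrite // eq_sym. Qed.

Lemma least_simplicial_indep x y :
  least_simplicial e x -> least_simplicial e y -> ~~ e x y.
Proof.
case/andP=> xs /existsPn xl /andP[ys /existsPn yl]; apply/negP=> exy.
have := xl y; have := yl x; rewrite exy (esym y) exy xs ys !andbT -!leqNgt => le1 le2.
have xy : x = y by apply: val_inj; apply/eqP; rewrite eqn_leq le1 le2.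
by rewrite xy eirr in exy.
Qed.

Lemma not_least_twin c : simplicial e c -> ~~ least_simplicial e c ->
  exists2 u, simplicial e u & e c u.
Proof.
rewrite /least_simplicial => -> /= /negPn /existsP[u /and3P[_ ec us]].
by exists u; rewrite // esym.
Qed.

Lemma least_exists v : simplicial e v ->
  exists2 u, least_simplicial e u & (u == v) || e v u.
Proof.
have [k] := ubnP (val v); elim: k v => // k IH v le_v vs.
have [vl|vnl] := boolP (least_simplicial e v); first by exists v; rewrite ?eqxx.
have : [exists u : 'I_n, [&& u < v, e u v & simplicial e u]].
  by move: vnl; rewrite /least_simplicial vs negbK.
case/existsP=> u /and3P[uv euv us].
have [|w wl wu] := IH u _ us; first by move: le_v; rewrite !ltnS; apply: leq_trans.
exists w => //; case/orP: wu => [/eqP->|euw]; first by rewrite esym euv orbT.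
by have [//|wv] := eqVneq w v; rewrite (simplicial_twin us euv euw) //.
Qed.

(** Supplies [Knbr]. A simplicial [c] is adjacent to the least vertex of its twin class. Otherwise
    two neighbours of [c] are non-adjacent, so one of them lies outside [K] and is simplicial, and
    the least vertex of its class is adjacent to [c] too. *)
Lemma least_nbr c : split_graph e -> ~~ least_simplicial e c ->
  exists2 u, least_simplicial e u & e c u.
Proof.
case=> K [Kcl Sin] nl; have [cs|cns] := boolP (simplicial e c).
  have [u us ecu] := not_least_twin cs nl.
  have [w wl wc] := least_exists cs; exists w => //.
  case/orP: wc => // /eqP wc; by rewrite wc (negbTE nl) in wl.
have inS x : x \notin K -> simplicial e x.
  move=> xK; apply/simplicialP=> y z xy xz yz.
  have inK w : e x w -> w \in K.
    apply: contraLR => wK; apply: Sin; rewrite !inE //.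
  by apply: Kcl => //; apply: inK.
case/forallPn: cns => x /forallPn[y]; rewrite negb_imply => /andP[/and3P[cx cy xy] nxy].
have [z zc zK] : exists2 z, e c z & z \notin K.
  have [xK|] := boolP (x \in K); last by exists x.
  have [yK|] := boolP (y \in K); last by exists y.
  by rewrite Kcl in nxy.
have [w wl wz] := least_exists (inS z zK); exists w => //.
case/orP: wz => [/eqP-> //|zw].
have [wc|wc] := eqVneq w c; first by rewrite wc (negbTE nl) in wl.
by rewrite (simplicial_twin (inS z zK)) // esym.
Qed.

(** A non-least vertex outside [K] has a simplicial twin, necessarily in [K], and inherits its
    neighbours; so it is adjacent to all of [K]. For two such vertices the twin of one links
    them. *)
Lemma least_clique : split_graph e -> forall x y,
  ~~ least_simplicial e x -> ~~ least_simplicial e y -> x != y -> e x y.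
Proof.
case=> K [Kcl Sin].
have inK x w : x \notin K -> e x w -> w \in K.
  by move=> xK; apply: contraLR => wK; apply: Sin; rewrite !inE.
have inS x : x \notin K -> simplicial e x.
  by move=> xK; apply/simplicialP=> y z xy xz yz; apply: Kcl; rewrite // (inK x).
have full x k : ~~ least_simplicial e x -> x \notin K -> k \in K -> e x k.
  move=> xnl xK kK; have [u us xu] := not_least_twin (inS x xK) xnl.
  have uK := inK x u xK xu.
  have [<- //|ku] := eqVneq u k.
  apply: simplicial_twin us _ (Kcl _ _ uK kK ku) _; first by rewrite esym.
  by apply: contraNneq xK => <-.
move=> x y xnl ynl xy.
have [xK|xK] := boolP (x \in K); have [yK|yK] := boolP (y \in K).
- exact: Kcl.
- by rewrite esym; apply: full.
- exact: full.
have [u us xu] := not_least_twin (inS x xK) xnl.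
have uK := inK x u xK xu.
have uy : e u y by rewrite esym; apply: full.
by apply: simplicial_twin us _ uy _; rewrite // 1?esym // eq_sym.
Qed.

End Partition.

(** * Evaluation on the register machine *)

(** The base [n.+1] is positive, so exponents may be raised when bounds are added. *)
Definition poly (T : nat -> nat) := exists C k, forall n, T n <= C * n.+1 ^ k.

Lemma poly_const c : poly (fun=> c).
Proof. by exists c, 0 => n; rewrite muln1. Qed.

Lemma poly_id : poly id.
Proof. by exists 1, 1 => n; rewrite mul1n; apply: leqnSn. Qed.

Lemma poly_add T1 T2 : poly T1 -> poly T2 -> poly (fun n => T1 n + T2 n).
Proof.
case=> [C1 [k1 le1]] [C2 [k2 le2]]; exists (C1 + C2), (k1 + k2) => n.
rewrite mulnDl; apply: leq_add.
  by apply: leq_trans (le1 n) _; rewrite leq_mul2l leq_pexp2l ?leq_addr ?orbT.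
by apply: leq_trans (le2 n) _; rewrite leq_mul2l leq_pexp2l ?leq_addl ?orbT.
Qed.

Lemma poly_mul T1 T2 : poly T1 -> poly T2 -> poly (fun n => T1 n * T2 n).
Proof.
case=> [C1 [k1 le1]] [C2 [k2 le2]]; exists (C1 * C2), (k1 + k2) => n.
by rewrite expnD mulnACA leq_mul.
Qed.

Definition runs P w b c c' := exists2 t, t <= b & iter t (step P w) c = c'.

Lemma runs_refl P w b c : runs P w b c c.
Proof. by exists 0. Qed.

Lemma runs_trans P w b1 b2 c1 c2 c3 :
  runs P w b1 c1 c2 -> runs P w b2 c2 c3 -> runs P w (b1 + b2) c1 c3.
Proof.
case=> t1 le1 <- [t2 le2 <-]; exists (t2 + t1); first by rewrite addnC leq_add.
by rewrite iterD.
Qed.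

Lemma runs_step P w b c c' : runs P w b (step P w c) c' -> runs P w b.+1 c c'.
Proof. by case=> t le_t <-; exists t.+1; rewrite // iterSr. Qed.

Lemma runs_le P w b1 b2 c c' : b1 <= b2 -> runs P w b1 c c' -> runs P w b2 c c'.
Proof. by move=> le12 [t le_t <-]; exists t => //; apply: leq_trans le12. Qed.

(** Jump targets are absolute, so a code fragment is tied to the address at which it sits. *)
Fixpoint code_at (P : program) p (code : program) : Prop :=
  if code is i :: code' then nth (IHalt false) P p = i /\ code_at P p.+1 code'
  else True.

Lemma code_at_cat P p c1 c2 :
  code_at P p (c1 ++ c2) <-> code_at P p c1 /\ code_at P (p + size c1) c2.
Proof.
elim: c1 p => [|i c1 IH] p /=; first by rewrite addn0; split=> [|[]].
by rewrite IH addSnnS; split=> [[? []]|[[]]].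
Qed.

Lemma code_at_self pre c post : code_at (pre ++ c ++ post) (size pre) c.
Proof.
elim: c pre => //= i c IH pre; split; first by rewrite nth_cat ltnn subnn.
by rewrite -cat1s catA -[(size pre).+1]addn1 -(size_cat pre [:: i]).
Qed.

Record instance := Instance {
  order : nat;
  adj : rel 'I_order;
  src : {set 'I_order};
  dst : {set 'I_order} }.

Definition word g := encode (@adj g) (src g) (dst g).

(* The values of the variables in scope, for each instance, the last bound
   variable first. *)
Record context := Context {
  carrier :> instance -> Type;
  values : forall g, carrier g -> seq nat }.

Implicit Types G : context.

Definition with_nat (G : context) :=
  @Context (fun g => G g * nat)%type (fun g x => x.2 :: values x.1).

Definition with_vertex (G : context) :=
  @Context (fun g => G g * 'I_(order g))%type (fun g x => val x.2 :: values x.1).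

(** Preservation of the registers below [s] is what lets evaluations be nested. *)
Definition evaluates P w T p q s R v := exists R',
  [/\ runs P w T (Config p R) (Config q R'), R' s = v & forall i, i < s -> R' i = R i].

(* [rho] lists the registers holding the variables in scope; registers from [s]
   on are scratch space, and the result is left in [s]. *)
Definition computable (G : context) (f : forall g, G g -> nat) :=
  exists2 T, poly T & forall rho s p, all (fun r => r < s) rho ->
  exists code, forall P, code_at P p code -> forall g (x : G g) R,
    [seq R r | r <- rho] = values x ->
    evaluates P (word g) (T (order g)) p (p + size code) s R (f g x).

Lemma computable_ext G (f f' : forall g, G g -> nat) :
  (forall g x, f g x = f' g x) -> computable f -> computable f'.
Proof.
move=> ff' [T pT cT]; exists T => // rho s p rho_s; have [code ccode] := cT rho s p rho_s.
by exists code => P cP g x R Rx; rewrite -ff'; apply: ccode.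
Qed.

Ltac machine_step H := apply: runs_step; rewrite /step /fetch /= H.
Ltac registers := rewrite /=; repeat (case: eqP => ?; try (exfalso; lia)).

Lemma computable_const G c : @computable G (fun _ _ => c).
Proof.
exists (fun=> 1); first exact: poly_const.
move=> rho s p _; exists [:: IConst s c] => P [Pp _] g x R _.
eexists; split=> [||i lt_i]; first by machine_step Pp; rewrite addn1; apply: runs_refl.
  by rewrite /= eqxx.
by rewrite /= ltn_eqF.
Qed.

Lemma computable_value G i : @computable G (fun g x => nth 0 (values x) i).
Proof.
exists (fun=> 2); first exact: poly_const.
(* Adding the zero just stored in [s] copies a register; the default [s] of [nth] makes an index out
   of range read this zero. *)
move=> rho s p rho_s; exists [:: IConst s 0; IAdd s (nth s rho i) s].
move=> P [Pp [Pp1 _]] g x R Rx.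
eexists; split=> [||j lt_j].
- by machine_step Pp; machine_step Pp1; rewrite addn2; apply: runs_refl.
- rewrite /= !eqxx addn0 -Rx; have [lt_i|ge_i] := ltnP i (size rho).
    by rewrite (nth_map s) // ltn_eqF // (allP rho_s) // mem_nth.
  by rewrite nth_default // eqxx nth_default // size_map.
- by rewrite /= !ltn_eqF.
Qed.

(** Weakening: the code for the outer scope is compiled with the register of the innermost variable
    dropped. *)
Lemma computable_behead G G' (pr : forall g, G' g -> G g) (f : forall g, G g -> nat) :
  (forall g x, values (pr g x) = behead (values x)) ->
  computable f -> @computable G' (fun g x => f g (pr g x)).
Proof.
move=> prE [T pT cT]; exists T => // rho s p rho_s.
have rho'_s : all (fun r => r < s) (behead rho) by case: rho rho_s => //= r rho /andP[].
have [code ccode] := cT _ s p rho'_s; exists code => P cP g x R Rx.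
by apply: ccode => //; rewrite prE -Rx behead_map.
Qed.

Lemma computable_lift_vertex G (f : forall g, G g -> nat)
    (f' : forall g, with_vertex G g -> nat) :
  (forall g x i, f' g (x, i) = f g x) -> computable f -> computable f'.
Proof.
move=> f'E cf.
apply: computable_ext (computable_behead (G' := with_vertex G) (pr := fun g => fst) _ cf) => //.
by move=> g [x i]; rewrite f'E.
Qed.

Lemma computable_lift_nat G (f : forall g, G g -> nat) (f' : forall g, with_nat G g -> nat) :
  (forall g x i, f' g (x, i) = f g x) -> computable f -> computable f'.
Proof.
move=> f'E cf.
apply: computable_ext (computable_behead (G' := with_nat G) (pr := fun g => fst) _ cf) => //.
by move=> g [x i]; rewrite f'E.
Qed.

Lemma computable_last_vertex G : @computable (with_vertex G) (fun g x => val x.2).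
Proof. by apply: computable_ext (computable_value (with_vertex G) 0). Qed.

Lemma computable_last_nat G : @computable (with_nat G) (fun g x => x.2).
Proof. by apply: computable_ext (computable_value (with_nat G) 0). Qed.

Lemma evaluates_seq P w T1 T2 p q r s R v1 v2 :
  evaluates P w T1 p q s R v1 ->
  (forall R1, R1 s = v1 -> (forall i, i < s -> R1 i = R i) ->
     evaluates P w T2 q r s R1 v2) ->
  evaluates P w (T1 + T2) p r s R v2.
Proof.
case=> R1 [run1 R1s R1i] /(_ R1 R1s R1i) [R2 [run2 R2s R2i]].
exists R2; split=> // [|i lt_i]; first exact: runs_trans run1 run2.
by rewrite R2i ?R1i.
Qed.

Lemma map_below (rho : seq nat) s (R R' : nat -> nat) :
  all (fun r => r < s) rho -> (forall i, i < s -> R' i = R i) ->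
  [seq R' r | r <- rho] = [seq R r | r <- rho].
Proof. by move=> /allP rho_s RR'; apply/eq_in_map => r /rho_s /RR'. Qed.

Lemma all_below (rho : seq nat) s s' :
  s <= s' -> all (fun r => r < s) rho -> all (fun r => r < s') rho.
Proof. by move=> le_s; apply: sub_all => r lt_r; apply: leq_trans le_s. Qed.

Lemma computable_binary G (op : nat -> nat -> nat) (mk : nat -> nat -> nat -> instr)
    (f1 f2 : forall g, G g -> nat) :
  (forall P w p R i j k, nth (IHalt false) P p = mk i j k ->
     step P w (Config p R) = set_reg (Config p R) i (op (R j) (R k))) ->
  computable f1 -> computable f2 -> @computable G (fun g x => op (f1 g x) (f2 g x)).
Proof.
move=> mkE [T1 p1 c1] [T2 p2 c2].
exists (fun n => T1 n + (T2 n + 1)).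
  by apply: poly_add => //; apply: poly_add => //; apply: poly_const.
move=> rho s p rho_s.
have [code1 cc1] := c1 rho s p rho_s.
(* The scratch space of the second operand starts at [s.+1], since [s] holds the first result. *)
have [code2 cc2] := c2 rho s.+1 (p + size code1) (all_below (leqnSn s) rho_s).
exists (code1 ++ code2 ++ [:: mk s s s.+1]) => P /code_at_cat[P1 /code_at_cat[P2 [P3 _]]].
move=> g x R Rx; set r := p + size _.
have -> : r = (p + size code1 + size code2).+1 by rewrite /r !size_cat /=; lia.
apply: (evaluates_seq (cc1 P P1 g x R Rx)) => R1 R1s R1i.
have [R2 [run2 R2s R2i]] : evaluates P (word g) (T2 (order g)) (p + size code1)
    (p + size code1 + size code2) s.+1 R1 (f2 g x).
  by apply: cc2 => //; rewrite (map_below rho_s R1i).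
eexists; split=> [||i lt_i].
- apply: runs_trans run2 _; apply: runs_step; rewrite (mkE _ _ _ _ _ _ _ P3).
  exact: runs_refl.
- by rewrite /= eqxx R2s R2i // R1s.
- by rewrite /= ltn_eqF // R2i // ltnW.
Qed.

Lemma computable_add G (f1 f2 : forall g, G g -> nat) :
  computable f1 -> computable f2 -> computable (fun g x => f1 g x + f2 g x).
Proof.
apply: (computable_binary (mk := IAdd)) => P w p R i j k Pp.
by rewrite /step /fetch /= Pp.
Qed.

Lemma computable_sub G (f1 f2 : forall g, G g -> nat) :
  computable f1 -> computable f2 -> computable (fun g x => f1 g x - f2 g x).
Proof.
apply: (computable_binary (mk := ISub)) => P w p R i j k Pp.
by rewrite /step /fetch /= Pp.
Qed.

Lemma computable_read G (f : forall g, G g -> nat) :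
  computable f -> computable (fun g x => nth 0 (word g) (f g x)).
Proof.
case=> T p1 c1; exists (fun n => T n + 1); first by apply: poly_add => //; apply: poly_const.
move=> rho s p rho_s; have [code cc] := c1 rho s p rho_s.
exists (code ++ [:: IRead s s]) => P /code_at_cat[P1 [P2 _]] g x R Rx.
set r := p + size _.
have -> : r = (p + size code).+1 by rewrite /r size_cat /=; lia.
apply: (evaluates_seq (cc P P1 g x R Rx)) => R1 R1s R1i.
eexists; split=> [||i lt_i]; first by machine_step P2; apply: runs_refl.
  by rewrite /= eqxx R1s.
by rewrite /= ltn_eqF // R1i.
Qed.

Lemma computable_ifpos G (c f1 f2 : forall g, G g -> nat) :
  computable c -> computable f1 -> computable f2 ->
  computable (fun g x => if 0 < c g x then f1 g x else f2 g x).
Proof.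
move=> [T p0 c0] [T1 p1 c1] [T2 p2 c2].
exists (fun n => T n + ((1 + (T2 n + 2)) + T1 n)).
  by do !(apply: poly_add => //); apply: poly_const.
move=> rho s p rho_s.
have [code cc] := c0 rho s p rho_s; set q := p + size code in cc.
have [code2 cc2] := c2 rho s q.+1 rho_s; set q2 := q.+1 + size code2 in cc2.
have [code1 cc1] := c1 rho s q2.+2 rho_s; set q1 := q2.+2 + size code1 in cc1.
(* The test jumps over the else branch; that branch ends with a jump on the constant 1, which skips
   the then branch. *)
exists (code ++ [:: IJpos s q2.+2] ++ code2 ++ [:: IConst s.+1 1; IJpos s.+1 q1] ++ code1).
move=> P /code_at_cat[P0 [Pj]]; rewrite -/q.
move=> /code_at_cat[P2 [Pc [Pj2 P1]]] g x R Rx; rewrite -/q2 in Pc Pj2 P1.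
set r := p + size _; have -> : r = q1.
  by rewrite /r !size_cat /= /q1 /q2 /q; lia.
apply: (evaluates_seq (cc P P0 g x R Rx)) => R1 R1s R1i.
have R1x : [seq R1 r | r <- rho] = values x by rewrite (map_below rho_s R1i).
case: ifP => c_pos.
  have [R2 [run2 R2s R2i]] := cc1 P P1 g x R1 R1x.
  exists R2; split=> //.
  apply: (@runs_le _ _ (T1 (order g)).+1); first by lia.
  by machine_step Pj; rewrite R1s c_pos.
have [R2 [run2 R2s R2i]] := cc2 P P2 g x R1 R1x.
eexists; split=> [||i lt_i].
- apply: runs_le (leq_addr _ _) _; rewrite add1n; machine_step Pj; rewrite R1s c_pos.
  apply: runs_trans run2 _; machine_step Pc; machine_step Pj2; rewrite eqxx.
  exact: runs_refl.
- by registers.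
- by registers; rewrite R2i.
Qed.

Lemma computable_fold G (f0 : forall g, G g -> nat)
    (body : forall g, G g -> 'I_(order g) -> nat -> nat) :
  computable f0 ->
  @computable (with_nat (with_vertex G)) (fun g x => body g x.1.1 x.1.2 x.2) ->
  computable (fun g x => foldl (fun a i => body g x i a) (f0 g x) (enum 'I_(order g))).
Proof.
move=> [T0 p0 c0] [T p1 c1].
exists (fun n => T0 n + (5 + (n * (T n + 6) + 2))).
  apply: poly_add => //; apply: poly_add; first exact: poly_const.
  apply: poly_add; last exact: poly_const.
  by apply: poly_mul; [apply: poly_id | apply: poly_add => //; apply: poly_const].
move=> rho s p rho_s.
have [code0 cc0] := c0 rho s p rho_s; set q := p + size code0 in cc0.
have rho'_s : all (fun r => r < s.+3) [:: s, s.+1 & rho].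
  by rewrite /= !ltnS leqnSn (leq_trans (leqnSn s)) //=; apply: all_below rho_s; lia.
have [code cc] := c1 _ _ q.+4.+1 rho'_s; set q1 := q.+4.+1 + size code in cc.
(* Register [s] holds the accumulator, [s.+1] the loop index and [s.+2] the order, read from entry 0
   of the input; [s.+3] serves both for the number of rounds left and for the result of the body.
   The first jump enters the loop at its test, at address [q1.+4]. *)
exists (code0 ++ [:: IConst s.+1 0; IConst s.+2 0; IRead s.+2 s.+2; IConst s.+3 1;
                     IJpos s.+3 q1.+4]
  ++ code ++ [:: IConst s.+4 0; IAdd s s.+3 s.+4; IConst s.+4 1; IAdd s.+1 s.+1 s.+4;
                 ISub s.+3 s.+2 s.+1; IJpos s.+3 q.+4.+1]).
move=> P /code_at_cat[P0 []]; rewrite -/q => Q1 [Q2 [Q3 [Q4 [Q5]]]] /code_at_cat[].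
move=> P1; rewrite -/q1 => -[Q6 [Q7 [Q8 [Q9 [Q10 [Q11 _]]]]]] g x R Rx.
set r := p + size _; have -> : r = q1.+4.+2.
  by rewrite /r !size_cat /= /q1 /q; lia.
apply: (evaluates_seq (cc0 P P0 g x R Rx)) => R1 R1s R1i.
(* Invariant at the loop test: [pre] is done and [l] remains; a round costs at most the body plus
   six steps. *)
have loop l pre R2 : enum 'I_(order g) = pre ++ l -> R2 s.+1 = size pre ->
    R2 s.+2 = order g -> (forall i, i < s -> R2 i = R i) ->
    evaluates P (word g) (size l * (T (order g) + 6) + 2) q1.+4 q1.+4.+2 s R2
      (foldl (fun a i => body g x i a) (R2 s) l).
  elim: l pre R2 => [|i l IH] pre R2 enumE R2p R2n R2i.
    have sz : size pre = order g.
      by have := size_enum_ord (order g); rewrite enumE cats0.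
    eexists; split=> [||i lt_i].
    - machine_step Q10; machine_step Q11; rewrite eqxx R2n R2p sz subnn.
      exact: runs_refl.
    - by registers.
    - by registers.
  have sz : size pre < order g.
    by have := size_enum_ord (order g); rewrite enumE size_cat /=; lia.
  have vi : val i = size pre.
    by rewrite /= -(nth_enum_ord i sz) enumE nth_cat ltnn subnn.
  have [R3 [run3 [R3s R3p R3n R3i]]] : exists R3,
      runs P (word g) (T (order g) + 6) (Config q1.+4 R2) (Config q1.+4 R3) /\
      [/\ R3 s = body g x i (R2 s), R3 s.+1 = (size pre).+1, R3 s.+2 = order g
        & forall j, j < s -> R3 j = R j].
    have [R4 [run4 R4s R4i]] : evaluates P (word g) (T (order g)) q.+4.+1 q1 s.+3
        [eta R2 with s.+3 |-> order g - size pre] (body g x i (R2 s)).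
      apply: (cc P P1 g (x, i, R2 s)); rewrite /= -Rx.
      congr [:: _, _ & _]; [by registers | by registers; rewrite R2p |].
      by apply: (map_below rho_s) => j lt_j; registers; apply: R2i.
    have R4p : R4 s.+1 = size pre by rewrite R4i //; registers.
    have R4n : R4 s.+2 = order g by rewrite R4i //; registers.
    eexists; split; last split.
    - apply: (@runs_le _ _ (T (order g) + 4).+2); first by lia.
      machine_step Q10; machine_step Q11; rewrite eqxx R2n R2p subn_gt0 sz.
      apply: runs_trans run4 _.
      machine_step Q6; machine_step Q7; machine_step Q8; machine_step Q9.
      exact: runs_refl.
    - by registers; rewrite R4s addn0.
    - by registers; rewrite R4p addn1.
    - by registers.
    - by move=> j lt_j; registers; rewrite R4i ?ltnS //; [registers; apply: R2i | lia].
  have [||||R5 [run5 R5s R5i]] := IH (rcons pre i) R3.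
  - by rewrite cat_rcons.
  - by rewrite size_rcons.
  - by [].
  - by [].
  exists R5; split.
  - rewrite /= mulSn -addnA; exact: runs_trans run3 run5.
  - by rewrite R5s R3s.
  - by move=> j lt_j; rewrite R5i // R3i // R2i.
have [] := loop _ [::] [eta [eta [eta [eta R1 with s.+1 |-> 0] with s.+2 |-> 0]
  with s.+2 |-> order g] with s.+3 |-> 1] erefl.
- by registers.
- by registers.
- by move=> j lt_j; registers; apply: R1i.
move=> R5 [run5 R5s R5i]; exists R5; split.
- machine_step Q1; machine_step Q2; machine_step Q3; machine_step Q4; machine_step Q5.
  by rewrite !eqxx /=; rewrite size_enum_ord in run5.
- by rewrite R5s; registers; rewrite R1s.
- by move=> j lt_j; rewrite R5i //; registers.
Qed.

(** * Closure properties *)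

Definition computable_bool G (b : forall g, G g -> bool) :=
  computable (fun g x => nat_of_bool (b g x)).

Definition computable_vertex G (a : forall g, G g -> 'I_(order g)) :=
  computable (fun g x => val (a g x)).

(** Quantification over contexts allows use under any number of bound variables. *)
Definition computable_pred (A : forall g, pred 'I_(order g)) :=
  forall G (a : forall g, G g -> 'I_(order g)),
    computable_vertex a -> computable_bool (fun g x => A g (a g x)).

Definition computable_rel (r : forall g, rel 'I_(order g)) :=
  forall G (a b : forall g, G g -> 'I_(order g)),
    computable_vertex a -> computable_vertex b ->
    computable_bool (fun g x => r g (a g x) (b g x)).

Definition computable_set (A : forall g, {set 'I_(order g)}) :=
  computable_pred (fun g x => x \in A g).

Ltac lift := rewrite /computable_vertex /computable_bool;
  first [eapply computable_lift_nat | eapply computable_lift_vertex];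
  [by move=> g x i; cbv beta iota delta [fst snd]; reflexivity|];
  cbv beta.

Ltac vertex := rewrite /computable_vertex;
  repeat (first [assumption | exact: computable_last_vertex | lift]).

Lemma computable_order G : @computable G (fun g x => order g).
Proof. exact: computable_read (computable_const G 0). Qed.

Section Booleans.
Variable G : context.
Implicit Types (b : forall g, G g -> bool) (f : forall g, G g -> nat).

Lemma computable_if b f1 f2 : computable_bool b -> computable f1 -> computable f2 ->
  computable (fun g x => if b g x then f1 g x else f2 g x).
Proof.
move=> cb c1 c2; apply: computable_ext (computable_ifpos cb c1 c2) => g x.
by case: (b g x).
Qed.

Lemma computable_true : @computable_bool G (fun g x => true).
Proof. exact: computable_const. Qed.

Lemma computable_false : @computable_bool G (fun g x => false).
Proof. exact: computable_const. Qed.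

Lemma computable_andb b1 b2 : computable_bool b1 -> computable_bool b2 ->
  computable_bool (fun g x => b1 g x && b2 g x).
Proof.
move=> c1 c2; apply: computable_ext (computable_if c1 c2 computable_false) => g x.
by case: (b1 g x).
Qed.

Lemma computable_negb b : computable_bool b -> computable_bool (fun g x => ~~ b g x).
Proof.
move=> c1; apply: computable_ext (computable_if c1 computable_false computable_true) => g x.
by case: (b g x).
Qed.

Lemma computable_orb b1 b2 : computable_bool b1 -> computable_bool b2 ->
  computable_bool (fun g x => b1 g x || b2 g x).
Proof.
move=> c1 c2; apply: computable_ext (computable_if c1 computable_true c2) => g x.
by case: (b1 g x).
Qed.

Lemma computable_implb b1 b2 : computable_bool b1 -> computable_bool b2 ->
  computable_bool (fun g x => b1 g x ==> b2 g x).
Proof.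
move=> c1 c2; apply: computable_ext (computable_if c1 c2 computable_true) => g x.
by case: (b1 g x).
Qed.

Lemma computable_ltn f1 f2 : computable f1 -> computable f2 ->
  computable_bool (fun g x => f1 g x < f2 g x).
Proof.
move=> c1 c2.
apply: computable_ext (computable_ifpos (computable_sub c2 c1) computable_true computable_false).
by move=> g x; rewrite subn_gt0; case: ltnP.
Qed.

Lemma computable_leq f1 f2 : computable f1 -> computable f2 ->
  computable_bool (fun g x => f1 g x <= f2 g x).
Proof.
move=> c1 c2; apply: computable_ext (computable_negb (computable_ltn c2 c1)) => g x.
by rewrite -leqNgt.
Qed.

Lemma computable_eqn f1 f2 : computable f1 -> computable f2 ->
  computable_bool (fun g x => f1 g x == f2 g x).
Proof.
move=> c1 c2.
apply: computable_ext (computable_andb (computable_leq c1 c2) (computable_leq c2 c1)) => g x.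
by rewrite eqn_leq.
Qed.

Lemma computable_eqb b1 b2 : computable_bool b1 -> computable_bool b2 ->
  computable_bool (fun g x => b1 g x == b2 g x).
Proof.
move=> c1 c2; apply: computable_ext (computable_eqn c1 c2) => g x.
by case: (b1 g x); case: (b2 g x).
Qed.

Lemma computable_eqv (a1 a2 : forall g, G g -> 'I_(order g)) :
  computable_vertex a1 -> computable_vertex a2 ->
  computable_bool (fun g x => a1 g x == a2 g x).
Proof. by move=> c1 c2; apply: computable_ext (computable_eqn c1 c2). Qed.

End Booleans.

Lemma foldl_sum (T : Type) (F : T -> nat) (s : seq T) a :
  foldl (fun a i => a + F i) a s = a + \sum_(i <- s) F i.
Proof.
elim: s a => [|i s IH] a /=; first by rewrite big_nil addn0.
by rewrite IH big_cons addnA.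
Qed.

Lemma computable_sum G (F : forall g, G g -> 'I_(order g) -> nat) :
  @computable (with_vertex G) (fun g x => F g x.1 x.2) ->
  computable (fun g x => \sum_i F g x i).
Proof.
move=> cF; pose body g (x : G g) i a := a + F g x i.
have c : @computable (with_nat (with_vertex G)) (fun g x => body g x.1.1 x.1.2 x.2).
  by apply: computable_add; [exact: computable_last_nat | lift].
apply: computable_ext (computable_fold (computable_const G 0) c) => g x.
by rewrite foldl_sum add0n big_enum.
Qed.

Lemma computable_card G (A : forall g, G g -> {set 'I_(order g)}) :
  @computable_bool (with_vertex G) (fun g x => x.2 \in A g x.1) ->
  computable (fun g x => #|A g x|).
Proof.
move/(computable_sum (F := fun g x i => nat_of_bool (i \in A g x))).
by apply: computable_ext => g x; rewrite -sum1_card [RHS]big_mkcond.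
Qed.

Lemma computable_exists G (b : forall g, G g -> 'I_(order g) -> bool) :
  @computable_bool (with_vertex G) (fun g x => b g x.1 x.2) ->
  computable_bool (fun g x => [exists i, b g x i]).
Proof.
move/(computable_sum (F := fun g x i => nat_of_bool (b g x i))) => c.
apply: computable_ext (computable_ltn (computable_const G 0) c) => g x.
congr nat_of_bool; rewrite lt0n sum_nat_eq0 negb_forall.
by apply: eq_existsb => i; case: (b g x i).
Qed.

Lemma computable_forall G (b : forall g, G g -> 'I_(order g) -> bool) :
  @computable_bool (with_vertex G) (fun g x => b g x.1 x.2) ->
  computable_bool (fun g x => [forall i, b g x i]).
Proof.
move=> /computable_negb/(computable_exists (b := fun g x i => ~~ b g x i)) c.
apply: computable_ext (computable_negb c) => g x; rewrite negb_exists.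
by congr nat_of_bool; apply: eq_forallb => i; rewrite negbK.
Qed.

Lemma nth_allpairs (S T U : Type) (f : S -> T -> U) (s : seq S) (t : seq T) x0 y0 z0 i j :
  i < size s -> j < size t ->
  nth z0 [seq f x y | x <- s, y <- t] (i * size t + j) = f (nth x0 s i) (nth y0 t j).
Proof.
elim: s i => //= x s IH [|i] lt_i lt_j; rewrite nth_cat size_map.
  by rewrite mul0n add0n lt_j (nth_map y0).
by rewrite mulSn -addnA ltnNge leq_addr /= addKn IH.
Qed.

(** The machine does not multiply; adding [f] once per vertex gives the product by the order, which
    suffices to index the rows of the matrix. *)
Lemma computable_product G (f : forall g, G g -> nat) :
  computable f -> computable (fun g x => f g x * order g).
Proof.
move=> cf; have := @computable_sum G (fun g x _ => f g x).
move=> /(_ ltac:(by lift)); apply: computable_ext => g x.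
by rewrite sum_nat_const card_ord mulnC.
Qed.

Lemma computable_adj : computable_rel adj.
Proof.
move=> G a b ca cb.
have := computable_read (computable_add (computable_const G 1)
  (computable_add (computable_product ca) cb)).
apply: computable_ext => g x; rewrite add1n /word /encode /=.
rewrite nth_cat size_allpairs size_enum_ord.
have [lt_a lt_b] := (ltn_ord (a g x), ltn_ord (b g x)).
rewrite ifT; last by nia.
have := nth_allpairs (fun u v => nat_of_bool (adj u v)) (a g x) (a g x) 0
   (s := enum 'I_(order g)) (t := enum 'I_(order g)) (i := a g x) (j := b g x).
by rewrite size_enum_ord !nth_ord_enum => ->.
Qed.

Lemma nth_charseq n (A : {set 'I_n}) s (i : 'I_n) :
  nth 0 ([seq nat_of_bool (x \in A) | x <- enum 'I_n] ++ s) i = (i \in A).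
Proof.
by rewrite nth_cat size_map size_enum_ord ltn_ord (nth_map i) ?size_enum_ord // nth_ord_enum.
Qed.

Lemma computable_src : computable_set src.
Proof.
move=> G a ca.
have := computable_read (computable_add (computable_const G 1)
  (computable_add (computable_product (computable_order G)) ca)).
apply: computable_ext => g x; rewrite add1n /word /encode /=.
rewrite nth_cat size_allpairs size_enum_ord ltnNge leq_addr /= addKn.
exact: nth_charseq.
Qed.

Lemma computable_dst : computable_set dst.
Proof.
move=> G a ca.
have := computable_read (computable_add (computable_const G 1)
  (computable_add (computable_product (computable_order G))
    (computable_add (computable_order G) ca))).
apply: computable_ext => g x; rewrite add1n /word /encode /=.
rewrite nth_cat size_allpairs size_enum_ord ltnNge leq_addr /= addKn.
rewrite nth_cat size_map size_enum_ord ltnNge leq_addr /= addKn.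
by have := nth_charseq (dst g) [::] (a g x); rewrite cats0.
Qed.

Lemma foldl_enum n (F : nat -> nat -> nat) a :
  foldl (fun a (i : 'I_n) => F a i) a (enum 'I_n) = foldl F a (iota 0 n).
Proof. by rewrite -val_enum_ord; elim: (enum _) a => //= i s IH a; rewrite IH. Qed.

Lemma foldl_double j n :
  foldl (fun a i => if i < j then a + a else a) 1 (iota 0 n) = 2 ^ minn j n.
Proof.
elim: n => [|n IH]; first by rewrite minn0.
rewrite -[n.+1]addn1 iotaD foldl_cat IH /= add0n addnn -mul2n -expnS.
by case: ltnP => ?; congr (2 ^ _); lia.
Qed.

(** Repeated doubling in a loop over the vertices, whose number caps the exponent. The exponents
    used later never exceed the order. *)
Lemma computable_exp2 G (f : forall g, G g -> nat) :
  computable f -> computable (fun g x => 2 ^ minn (f g x) (order g)).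
Proof.
move=> cf; pose body g (x : G g) (i : 'I_(order g)) a := if i < f g x then a + a else a.
have c : @computable (with_nat (with_vertex G)) (fun g x => body g x.1.1 x.1.2 x.2).
  apply: computable_if; first by apply: computable_ltn; [vertex | do 2 lift].
    by apply: computable_add; apply: computable_last_nat.
  exact: computable_last_nat.
apply: computable_ext (computable_fold (computable_const G 1) c) => g x.
by rewrite -foldl_double -(foldl_enum _ (fun a i => if i < f g x then a + a else a)).
Qed.

(** * Connectivity *)

Definition bits (b : nat -> bool) m := \sum_(v < m) b v * 2 ^ v.

Lemma bitsS b m : bits b m.+1 = bits b m + b m * 2 ^ m.
Proof. by rewrite /bits big_ord_recr. Qed.

Lemma bits_lt b m : bits b m < 2 ^ m.
Proof.
elim: m => [|m IH]; first by rewrite /bits big_ord0.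
by rewrite bitsS expnS; case: (b m); lia.
Qed.

(** The digits below position [m] sum to less than [2 ^ m], so a comparison reads the leading
    digit. *)
Lemma bits_top b m : (2 ^ m <= bits b m.+1) = b m.
Proof.
rewrite bitsS; have := bits_lt b m; case: (b m); first by rewrite mul1n leq_addl.
by rewrite mul0n addn0 ltnNge => /negbTE.
Qed.

(* Reading the binary digits from the top, clear all those above the u-th one. *)
Definition strip n u a i := if (u < n - i.+1) && (2 ^ (n - i.+1) <= a)
  then a - 2 ^ (n - i.+1) else a.

Lemma foldl_strip b n u : u < n ->
  foldl (strip n u) (bits b n) (iota 0 n) = bits b u.+1.
Proof.
(* When the positions below [k] are left to inspect, the digits from [maxn k u.+1] on have been
   cleared. *)
move=> lt_un; suff main k : k <= n ->
    foldl (strip n u) (bits b (maxn k u.+1)) (iota (n - k) k) = bits b u.+1.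
  by have := main n (leqnn n); rewrite subnn (maxn_idPl lt_un).
elim: k => [|k IH] lt_k /=; first by rewrite max0n.
have -> : (n - k.+1).+1 = n - k by lia.
rewrite -{}[RHS]IH; last exact: ltnW.
congr foldl; rewrite /strip; have -> : n - (n - k.+1).+1 = k by lia.
have [lt_uk|ge_uk] := ltnP u k; last first.
  by congr bits; lia.
have -> : maxn k.+1 u.+1 = k.+1 by lia.
have -> : maxn k u.+1 = k by lia.
by rewrite bits_top bitsS; case: (b k); [rewrite mul1n addnK | rewrite mul0n addn0].
Qed.

Definition set_code n (A : {set 'I_n}) := \sum_(v in A) 2 ^ v.

Lemma set_codeE n (A : {set 'I_n}) :
  set_code A = bits (fun v => if insub v is Some i then i \in A else false) n.
Proof.
rewrite /set_code big_mkcond; apply: eq_bigr => v _; rewrite valK.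
by case: (v \in A); rewrite ?mul1n ?mul0n.
Qed.

(** With no division at hand, digit [u] is read by a comparison once all higher digits have been
    cleared. *)
Definition set_bit n (X : nat) (u : 'I_n) :=
  2 ^ u <= foldl (fun a (i : 'I_n) => strip n u a i) X (enum 'I_n).

Lemma set_bitE n (A : {set 'I_n}) u : set_bit (set_code A) u = (u \in A).
Proof.
rewrite /set_bit (foldl_enum _ (strip n u)) set_codeE foldl_strip //.
by rewrite bits_top valK.
Qed.

Lemma computable_set_bit G (X : forall g, G g -> nat) (u : forall g, G g -> 'I_(order g)) :
  computable X -> computable_vertex u -> computable_bool (fun g x => set_bit (X g x) (u g x)).
Proof.
move=> cX cu.
have le_ord g (i : 'I_(order g)) : order g - i.+1 <= order g by apply: leq_subr.
have pw G' (a : forall g, G' g -> 'I_(order g)) :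
    computable_vertex a -> computable (fun g x => order g - (a g x).+1).
  move=> ca; apply: computable_sub; first exact: computable_order.
  by apply: computable_ext (computable_add ca (computable_const G' 1)) => g x; rewrite addn1.
pose body g (x : G g) (i : 'I_(order g)) a :=
  if (u g x < order g - i.+1) && (2 ^ minn (order g - i.+1) (order g) <= a)
  then a - 2 ^ minn (order g - i.+1) (order g) else a.
have c : @computable (with_nat (with_vertex G)) (fun g x => body g x.1.1 x.1.2 x.2).
  have cp : @computable (with_nat (with_vertex G)) (fun g x => order g - x.1.2.+1).
    by apply: pw; vertex.
  apply: computable_if; last exact: computable_last_nat.
    apply: computable_andb; first by apply: computable_ltn => //; vertex.
    by apply: computable_leq; [apply: computable_exp2 | apply: computable_last_nat].
  by apply: computable_sub; [apply: computable_last_nat | apply: computable_exp2].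
apply: computable_ext (computable_leq (computable_exp2 cu) (computable_fold cX c)) => g x.
rewrite (minn_idPl (ltnW (ltn_ord _))) /set_bit; congr (nat_of_bool (_ <= _)).
move: (X g x); elim: (enum _) => //= i s IH a; rewrite IH /body /strip.
by rewrite (minn_idPl (leq_subr _ _)).
Qed.

Definition grow (T : finType) (r : rel T) (A : {set T}) :=
  [set v | (v \in A) || [exists u, (u \in A) && r u v]].

(** A duplicate-free path has fewer than [#|T|] steps, and surplus rounds do no harm because the
    sets only grow. *)
Lemma iter_grow (T : finType) (r : rel T) a v :
  (v \in iter #|T| (grow r) [set a]) = connect r a v.
Proof.
apply/idP/connectP.
  elim: #|T| v => [|k IH] v /=; first by rewrite inE => /eqP->; exists [::].
  rewrite inE => /orP[/IH //|/existsP[u /andP[/IH[p pth ->] ruv]]].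
  by exists (rcons p v); rewrite ?rcons_path ?pth ?last_rcons.
case=> p0 /shortenP[p pth uniq_p _] ->.
have le_p : size p <= #|T|.
  by rewrite ltnW // -[(size p).+1]/(size (a :: p)) -(card_uniqP uniq_p) max_card.
rewrite -(subnK le_p) iterD.
have keep k (B : {set T}) x : x \in B -> x \in iter k (grow r) B.
  by elim: k => //= k IH xB; rewrite inE IH.
apply: keep; elim/last_ind: p pth {uniq_p le_p} => [|p w IH] /=; first by rewrite inE.
rewrite rcons_path last_rcons size_rcons => /andP[pth rw]; rewrite inE.
by apply/orP; right; apply/existsP; exists (last a p); rewrite IH.
Qed.

Definition grow_code n (r : rel 'I_n) X :=
  \sum_v if set_bit X v || [exists u, set_bit X u && r u v] then 2 ^ v else 0.

Lemma grow_codeE n (r : rel 'I_n) A : grow_code r (set_code A) = set_code (grow r A).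
Proof.
rewrite /set_code [RHS]big_mkcond; apply: eq_bigr => v _; rewrite inE set_bitE.
by under eq_existsb => u do rewrite set_bitE.
Qed.

Lemma foldl_grow_code n (r : rel 'I_n) A (s : seq 'I_n) :
  foldl (fun X _ => grow_code r X) (set_code A) s = set_code (iter (size s) (grow r) A).
Proof. by elim: s A => //= i s IH A; rewrite grow_codeE IH -iterS iterSr. Qed.

Lemma computable_exp2v G (a : forall g, G g -> 'I_(order g)) :
  computable_vertex a -> computable (fun g x => 2 ^ a g x).
Proof.
move/computable_exp2; apply: computable_ext => g x.
by rewrite (minn_idPl (ltnW (ltn_ord _))).
Qed.

(** The set reached so far, coded as one number, is the accumulator of a fold over the vertices; the
    loop index only counts the rounds. *)
Lemma computable_connect (r : forall g, rel 'I_(order g)) :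
  computable_rel r -> computable_rel (fun g => connect (r g)).
Proof.
move=> cr G a b ca cb.
pose body g (x : G g) (i : 'I_(order g)) X := grow_code (r g) X.
have c : @computable (with_nat (with_vertex G)) (fun g x => body g x.1.1 x.1.2 x.2).
  apply: computable_sum; apply: computable_if; last exact: computable_const.
    apply: computable_orb.
      by apply: computable_set_bit; [lift; apply: computable_last_nat | vertex].
    apply: computable_exists; apply: computable_andb.
      by apply: computable_set_bit; [do 2 lift; apply: computable_last_nat | vertex].
    by apply: cr; vertex.
  by apply: computable_exp2v; vertex.
apply: computable_ext (computable_set_bit (computable_fold (computable_exp2v ca) c) cb) => g x.
rewrite -iter_grow card_ord -set_bitE; congr (nat_of_bool (set_bit _ _)).
have -> : 2 ^ a g x = set_code [set a g x] by rewrite /set_code big_set1.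
by rewrite /body foldl_grow_code size_enum_ord.
Qed.

(** * The decision procedure *)

Lemma computable_simplicial (e : forall g, rel 'I_(order g)) :
  computable_rel e -> computable_pred (fun g => simplicial (e g)).
Proof.
move=> ce G a ca; rewrite /simplicial.
do 2 apply: computable_forall.
apply: computable_implb; last by apply: ce; vertex.
do 2 (apply: computable_andb; first by apply: ce; vertex).
by apply: computable_negb; apply: computable_eqv; vertex.
Qed.

Lemma computable_least_simplicial (e : forall g, rel 'I_(order g)) :
  computable_rel e -> computable_pred (fun g => least_simplicial (e g)).
Proof.
move=> ce G a ca; rewrite /least_simplicial.
apply: computable_andb; first exact: computable_simplicial.
apply: computable_negb; apply: computable_exists.
apply: computable_andb; first by apply: computable_ltn; vertex.
apply: computable_andb; first by apply: ce; vertex.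
by apply: computable_simplicial => //; vertex.
Qed.

Section Algorithm.
Variables (e : forall g, rel 'I_(order g)) (S : forall g, pred 'I_(order g)).
Hypotheses (ce : computable_rel e) (cS : computable_pred S).
Implicit Types I J : forall g, {set 'I_(order g)}.

Ltac atom := by [apply: cS; vertex | apply: ce; vertex].

Lemma computable_touched : computable_pred (fun g => touched (@e g)).
Proof. by move=> G a ca; apply: computable_exists; atom. Qed.

Lemma computable_meet : computable_rel (fun g => meet (@e g) (@S g)).
Proof.
move=> G a b ca cb; rewrite /meet.
do 2 (apply: computable_andb; first by atom).
by apply: computable_exists; apply: computable_andb; atom.
Qed.

Lemma computable_comp G (a b : forall g, G g -> 'I_(order g)) :
  computable_vertex a -> computable_vertex b ->
  computable_bool (fun g x => b g x \in comp (@e g) (@S g) (a g x)).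
Proof.
move=> ca cb; apply: computable_ext (computable_connect computable_meet ca cb) => g x.
by rewrite inE.
Qed.

Lemma computable_deg G (a : forall g, G g -> 'I_(order g)) :
  computable_vertex a -> computable (fun g x => deg (@e g) (@S g) (a g x)).
Proof.
move=> ca; apply: computable_card.
apply: (@computable_ext (with_vertex G) (fun g x => nat_of_bool (S x.2 && e (a g x.1) x.2))).
  by move=> g x; rewrite inE.
by apply: computable_andb; atom.
Qed.

Lemma computable_compI G I (a : forall g, G g -> 'I_(order g)) :
  computable_set I -> computable_vertex a ->
  computable (fun g x => #|comp (@e g) (@S g) (a g x) :&: I g|).
Proof.
move=> cI ca; apply: computable_card.
apply: (@computable_ext (with_vertex G)
  (fun g x => nat_of_bool ((x.2 \in comp (@e g) (@S g) (a g x.1)) && (x.2 \in I g)))).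
  by move=> g x; rewrite in_setI.
by apply: computable_andb; [apply: computable_comp | apply: cI]; vertex.
Qed.

Lemma computable_inside G I :
  computable_set I -> @computable_bool G (fun g x => inside (@S g) (I g)).
Proof.
by move=> cI; apply: computable_forall; apply: computable_implb; [apply: cI; vertex | atom].
Qed.

Lemma computable_gate G I (c u : forall g, G g -> 'I_(order g)) :
  computable_set I -> computable_vertex c -> computable_vertex u ->
  computable_bool (fun g x => gate (@e g) (@S g) (I g) (c g x) (u g x)).
Proof.
move=> cI cc cu; rewrite /gate.
apply: computable_andb; first by apply: computable_negb; atom.
do 2 (apply: computable_andb; first by atom).
apply: computable_leq; apply: computable_add.
- exact: computable_compI.
- exact: computable_deg.
- by apply: computable_card; apply: computable_comp; vertex.
- exact: computable_inside.
Qed.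

Lemma computable_roomy G I (c m : forall g, G g -> 'I_(order g)) :
  computable_set I -> computable_vertex c -> computable_vertex m ->
  computable_bool (fun g x => roomy (@e g) (@S g) (I g) (c g x) (m g x)).
Proof.
move=> cI cc cm; apply: computable_leq; apply: computable_add.
- by apply: computable_add; apply: computable_deg.
- apply: computable_card.
  apply: (@computable_ext (with_vertex G)
    (fun g x => nat_of_bool ((x.2 \in I g) && touched (@e g) x.2))).
    by move=> g x; rewrite inE.
  by apply: computable_andb; [apply: cI | apply: computable_touched]; vertex.
- apply: computable_card.
  apply: (@computable_ext (with_vertex G)
    (fun g x => nat_of_bool (S x.2 && touched (@e g) x.2))).
    by move=> g x; rewrite inE.
  by apply: computable_andb; [apply: cS | apply: computable_touched]; vertex.
- exact: computable_const.
Qed.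

Lemma computable_hub G I :
  computable_set I -> @computable_bool G (fun g x => hub (@e g) (@S g) (I g)).
Proof.
move=> cI; rewrite /hub; do 3 apply: computable_exists.
apply: computable_andb; first by apply: computable_gate => //; vertex.
apply: computable_andb; first by apply: computable_negb; atom.
by apply: computable_roomy => //; vertex.
Qed.

Lemma computable_samecount G I J : computable_set I -> computable_set J ->
  @computable_bool G (fun g x => samecount (@e g) (@S g) (I g) (J g)).
Proof.
move=> cI cJ; rewrite /samecount.
do 2 (apply: computable_andb; first exact: computable_inside).
apply: computable_forall; apply: computable_implb; first by atom.
by apply: computable_eqn; apply: computable_compI => //; vertex.
Qed.

Lemma computable_samegate G I J : computable_set I -> computable_set J ->
  @computable_bool G (fun g x => samegate (@e g) (@S g) (I g) (J g)).
Proof.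
move=> cI cJ; rewrite /samegate; do 2 apply: computable_exists.
by apply: computable_andb; apply: computable_gate => //; vertex.
Qed.

Lemma computable_compatible G I J : computable_set I -> computable_set J ->
  @computable_bool G (fun g x => compatible (@e g) (I g) (J g)).
Proof.
move=> cI cJ; rewrite /compatible; apply: computable_andb.
  by apply: computable_eqn; apply: computable_card; [apply: cI | apply: cJ]; vertex.
apply: computable_forall; apply: computable_orb; first by apply: computable_touched; vertex.
by apply: computable_eqb; [apply: cI | apply: cJ]; vertex.
Qed.

Lemma computable_decide G I J : computable_set I -> computable_set J ->
  @computable_bool G (fun g x => decide (@e g) (@S g) (I g) (J g)).
Proof.
move=> cI cJ; rewrite /decide; apply: computable_andb; first exact: computable_compatible.
apply: computable_orb; first exact: computable_samecount.
apply: computable_orb; first exact: computable_samegate.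
by apply: computable_andb; apply: computable_hub.
Qed.

End Algorithm.

Definition closed : context := @Context (fun=> unit) (fun _ _ => [::]).

Lemma computable_answers (b : instance -> bool) :
  @computable_bool closed (fun g x => b g) ->
  exists (P : program) (c k : nat), forall g, exists t,
    t <= c * size (word g) ^ k + c /\ answers P (word g) t (b g).
Proof.
case=> T [C [k TC]] cT; have [code cc] := cT [::] 0 0 erefl.
(* The result lands in register 0 and selects one of the two halting instructions; [C.+1] leaves
   room for the step of this jump. *)
exists (code ++ [:: IJpos 0 (size code).+2; IHalt false; IHalt true]), C.+1, k => g.
set P := code ++ _.
have [P0 [Pj [Pf [Pt _]]]] : code_at P 0 code /\
    code_at P (size code) [:: IJpos 0 (size code).+2; IHalt false; IHalt true].
  by have := code_at_self [::] P [::]; rewrite cats0 => /code_at_cat.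
have [R [[t le_t run] R0 _]] := cc P P0 g tt (fun=> 0) erefl.
exists t.+1; split.
  (* The input has more than [order g] entries, so a polynomial bound in the order is one in the
     input length. *)
  have le_n : (order g).+1 <= size (word g).
    have sz (A : {set 'I_(order g)}) :
        size [seq nat_of_bool (x \in A) | x <- enum 'I_(order g)] = order g.
      by rewrite size_map size_enum_ord.
    by rewrite /word /encode /= size_cat size_cat !sz ltnS addnCA leq_addr.
  have le_T : T (order g) <= C * size (word g) ^ k.
    apply: leq_trans (TC _) _; rewrite leq_mul2l; case: (k) => [|k']; first by rewrite leqnn orbT.
    by rewrite leq_exp2r // le_n orbT.
  rewrite mulSn; lia.
rewrite /answers iterS /init run /step /fetch /= Pj R0.
by case: (b g); rewrite /= ?Pt ?Pf.
Qed.

Theorem theorem2 :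
  exists (P : program) (c k : nat),
  forall (n : nat) (e : rel 'I_n) (Is It : {set 'I_n}),
    symmetric e -> irreflexive e -> split_graph e ->
    independent e Is -> independent e It ->
    exists (t : nat) (b : bool),
      [/\ t <= c * size (encode e Is It) ^ k + c,
          answers P (encode e Is It) t b
        & b = true <-> reach2 e Is It].
Proof.
(* The partition is defined from the adjacency relation alone, so the machine can evaluate it along
   with the criterion. *)
have [|P [c [k Pok]]] := @computable_answers
    (fun g => decide (adj (i := g)) (least_simplicial (adj (i := g))) (src g) (dst g)).
  apply: computable_decide; [ | | exact: computable_src | exact: computable_dst].
    exact: computable_adj.
  by apply: computable_least_simplicial; apply: computable_adj.
exists P, c, k => n e Is It esym eirr split_e iIs iIt.
have [t [le_t ans]] := Pok (Instance e Is It).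
exists t; eexists; split; [exact: le_t | exact: ans |].
apply: decideP => //.
- exact: least_simplicial_indep.
- exact: least_clique.
- by move=> c0; apply: least_nbr.
Qed.
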